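(* Let $\Phi=(\Phi^{(j)})_{j\in\mathbb{N}}$ be a conformal NIFS on $(U,X)$, with $X$ connected, satisfying the Strong Separation Condition. Suppose there exist a strictly increasing sequence $(j_n)_{n\in\mathbb{N}}$ of positive integers and a sequence of conformal annuli $(A_{j_n})_{n\in\mathbb{N}}$ such that, for every $n$, both $A_{j_n}$ and the bounded component of $\mathbb{C}\setminus A_{j_n}$ are contained in $X$, the annulus $A_{j_n}$ separates $X_1^{(j_n)}=\bigcup_{i\in I^{(j_n)}}\varphi^{(j_n)}_i(X)$, and $\mathrm{mod}\,A_{j_n}\to\infty$ as $n\to\infty$. For each $n\in\mathbb{N}$ choose $m_n\in I^{(j_n)}$ such that the set $\varphi^{(j_n)}_{m_n}(X)$ is surrounded by $A_{j_n}$, i.e. is contained in the bounded component of $\mathbb{C}\setminus A_{j_n}$ (such a choice is possible since $X$ is connected and $A_{j_n}$ separates $X_1^{(j_n)}$), and fix $\omega=(\omega_1,\omega_2,\dots)\in I^\infty$ such that $\omega_{j_n}=m_n$ for all $n\in\mathbb{N}$. Then $J=J(\Phi)$ is pointwise thin at $\pi_\Phi(\omega)$.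
   Context: NIFS. Let $U\subseteq\mathbb{C}$ be non-empty, open and connected and let $X\subset U$ be compact. A non-autonomous iterated function system (NIFS) $\Phi$ on $(U,X)$ is a sequence $\Phi^{(1)},\Phi^{(2)},\dots$, where each $\Phi^{(j)}=(\varphi^{(j)}_i:U\to X)_{i\in I^{(j)}}$ is a collection of non-constant functions indexed by a non-empty set $I^{(j)}$ (of arbitrary cardinality), such that there exist $0<s<1$ and a metric $d$ on $U$, inducing the Euclidean topology on $X$, with $d(\varphi(z),\varphi(w))\le s\,d(z,w)$ for all $z,w\in X$ and all $\varphi\in\bigcup_j\Phi^{(j)}$. The NIFS is conformal if all its maps are analytic and one-to-one on $U$. It satisfies the Strong Separation Condition if $\varphi^{(j)}_a(X)\cap\varphi^{(j)}_b(X)=\emptyset$ for each $j\in\mathbb{N}$ and all distinct $a,b\in I^{(j)}$. Limit set and projection map. Let $I^k=\prod_{j=1}^k I^{(j)}$ and $I^\infty=\prod_{j=1}^\infty I^{(j)}$. For $\omega=\omega_1\cdots\omega_k\in I^k$ put $\varphi_\omega=\varphi^{(1)}_{\omega_1}\circ\cdots\circ\varphi^{(k)}_{\omega_k}$, and let $X_k=\bigcup_{\omega\in I^k}\varphi_\omega(X)$. The limit set is $J(\Phi)=\bigcap_{k=1}^\infty X_k$. The projection map $\pi_\Phi:I^\infty\to J(\Phi)$ sends $\omega\in I^\infty$ to the unique point of $\bigcap_{n=1}^\infty\varphi_{\omega_1\cdots\omega_n}(X)$. Annuli and thinness. A conformal annulus is a doubly connected domain $A\subset\mathbb{C}$ that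 can be mapped conformally onto a round annulus $\{z:r<|z-w|<R\}$ with $0<r<R<\infty$; its modulus is $\mathrm{mod}\,A=\log(R/r)$. It separates a set $F\subset\mathbb{C}$ if $F\cap A=\emptyset$ and $F$ meets both components of $\mathbb{C}\setminus A$. A set $E\subset\mathbb{C}$ is pointwise thin at $z\in E$ if there is a sequence of conformal annuli $A_n$, each of which separates $E$ and has $z$ in the bounded component of its complement, such that $\mathrm{mod}\,A_n\to+\infty$ while the Euclidean diameter of $A_n$ tends to $0$. *)

(* Defs.v *)
From HB Require Import structures.
From mathcomp Require Import all_boot all_order all_algebra.
From mathcomp Require Import all_classical all_reals all_analysis.
From mathcomp Require Import complex.

Set Implicit Arguments.
Unset Strict Implicit.
Unset Printing Implicit Defensive.

Import Order.TTheory GRing.Theory Num.Theory numFieldNormedType.Exports.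

Local Open Scope classical_set_scope.
Local Open Scope ring_scope.

(* The complex plane is [R[i]^o], the field [R[i]] seen as a normed space over
   itself: this carries the Euclidean topology, and [derivable f z 1] is complex
   differentiability at [z].  The norm [`|z|] lives in [R[i]]; its real value is
   [complex.Re `|z|]. *)

Definition conformal_on (R : realType) (U : set R[i]^o) (f : R[i]^o -> R[i]^o) :
    Prop :=
  (forall z, U z -> derivable f z 1) /\ set_inj U f.

Definition components (T : topologicalType) (S : set T) : set (set T) :=
  [set connected_component S z | z in S].

Definition doubly_connected (R : realType) (A : set R[i]^o) : Prop :=
  [/\ open A, A !=set0, connected A &
      exists B1 B2, B1 <> B2 /\ components (~` A) = [set B1; B2]].

Definition round_annulus (R : realType) (w : R[i]^o) (r s : R) : set R[i]^o :=
  [set z : R[i]^o | (r%:C)%C < `|z - w| /\ `|z - w| < (s%:C)%C].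

Definition maps_onto_round_annulus (R : realType) (A : set R[i]^o)
    (w : R[i]^o) (r s : R) : Prop :=
  exists f : R[i]^o -> R[i]^o,
    conformal_on A f /\ f @` A = round_annulus w r s.

Definition conformal_annulus (R : realType) (A : set R[i]^o) : Prop :=
  doubly_connected A /\
  exists w r s, [/\ 0 < r, r < s & maps_onto_round_annulus A w r s].

(* The ratio [s / r] is determined by [A] (conformal invariance), so for a
   conformal annulus the set below is a singleton. *)
Definition modulus (R : realType) (A : set R[i]^o) : R :=
  xget 0 [set m | exists w r s,
    [/\ 0 < r, r < s, maps_onto_round_annulus A w r s & m = ln (s / r)]].

(* A conformal annulus has exactly one bounded complementary component, so the
   union below then has a single term. *)
Definition bounded_component (R : realType) (A : set R[i]^o) : set R[i]^o :=
  \bigcup_(B in components (~` A) `&` bounded_set) B.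

Definition separates (R : realType) (A F : set R[i]^o) : Prop :=
  F `&` A = set0 /\ forall B, components (~` A) B -> F `&` B !=set0.

Definition diameter (R : realType) (A : set R[i]^o) : \bar R :=
  ereal_sup [set (complex.Re `|z - w|)%:E | z in A & w in A].

Definition pointwise_thin (R : realType) (E : set R[i]^o) (z : R[i]^o) : Prop :=
  E z /\
  exists A : nat -> set R[i]^o,
    [/\ forall n, [/\ conformal_annulus (A n), separates (A n) E &
                      bounded_component (A n) z],
        modulus (A n) @[n --> \oo] --> +oo &
        diameter (A n) @[n --> \oo] --> 0%E].

Definition metric_on (R : realType) (T : Type) (U : set T) (d : T -> T -> R) :
    Prop :=
  [/\ forall x y, U x -> U y -> 0 <= d x y,
      forall x y, U x -> U y -> (d x y = 0 <-> x = y),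
      forall x y, U x -> U y -> d x y = d y x &
      forall x y z, U x -> U y -> U z -> d x z <= d x y + d y z].

(* The topology of [d] restricted to [X] is the subspace topology of [X]. *)
Definition induces_topology_on (R : realType) (T : topologicalType) (X : set T)
    (d : T -> T -> R) : Prop :=
  forall V : set T, V `<=` X ->
    (exists2 O : set T, open O & V = O `&` X) <->
    (forall x, V x ->
       exists2 r : R, 0 < r & [set y | X y /\ d x y < r] `<=` V).

(* Levels are numbered from 0: [phi j] is the collection usually written with
   superscript [j + 1].  A map from [U] to [X] is a total function of which only
   the values on [U] matter. *)
Record is_NIFS (R : realType) (U X : set R[i]^o) (I : nat -> Type)
    (phi : forall j, I j -> R[i]^o -> R[i]^o) : Prop := {
  nifs_nonempty : U !=set0;
  nifs_open : open U;
  nifs_connected : connected U;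
  nifs_compact : compact X;
  nifs_subset : X `<=` U;
  nifs_inhabited : forall j, inhabited (I j);
  nifs_maps : forall j (i : I j) z, U z -> X (phi j i z);
  nifs_nonconstant : forall j (i : I j),
    exists z w, [/\ U z, U w & phi j i z <> phi j i w];
  nifs_contraction : exists (s : R) (d : R[i]^o -> R[i]^o -> R),
    [/\ 0 < s, s < 1, metric_on U d, induces_topology_on X d &
        forall j (i : I j) z w, X z -> X w ->
          d (phi j i z) (phi j i w) <= s * d z w] }.

Definition is_conformal_NIFS (R : realType) (U X : set R[i]^o) (I : nat -> Type)
    (phi : forall j, I j -> R[i]^o -> R[i]^o) : Prop :=
  is_NIFS U X phi /\ forall j (i : I j), conformal_on U (phi j i).

Definition strong_separation (R : realType) (X : set R[i]^o) (I : nat -> Type)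
    (phi : forall j, I j -> R[i]^o -> R[i]^o) : Prop :=
  forall j (a b : I j), a <> b -> (phi j a @` X) `&` (phi j b @` X) = set0.

Definition word (I : nat -> Type) (k : nat) : Type := forall j : 'I_k, I j.

Definition truncate (I : nat -> Type) (omega : forall j, I j) (k : nat) :
  word I k := fun j => omega j.
Arguments truncate {I} omega k.

(* Letter 0 is applied last: the map of [w] is phi_(w_0) o ... o phi_(w_(k-1)). *)
Fixpoint word_map (T : Type) (I : nat -> Type) (phi : forall j, I j -> T -> T)
    (k : nat) : word I k -> T -> T :=
  match k with
  | 0 => fun _ z => z
  | k'.+1 => fun w z =>
      word_map phi (fun j : 'I_k' => w (widen_ord (leqnSn k') j))
        (phi k' (w ord_max) z)
  end.

Definition first_level (R : realType) (X : set R[i]^o) (I : nat -> Type)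
    (phi : forall j, I j -> R[i]^o -> R[i]^o) (j : nat) : set R[i]^o :=
  \bigcup_(i : I j) (phi j i @` X).

Definition limit_set (R : realType) (X : set R[i]^o) (I : nat -> Type)
    (phi : forall j, I j -> R[i]^o -> R[i]^o) : set R[i]^o :=
  \bigcap_(k in [set k | (0 < k)%N])
    \bigcup_(w : word I k) (word_map phi w @` X).

(* For a NIFS the intersection is a single point. *)
Definition projection (R : realType) (X : set R[i]^o) (I : nat -> Type)
    (phi : forall j, I j -> R[i]^o -> R[i]^o) (omega : forall j, I j) : R[i]^o :=
  xget 0 (\bigcap_(n in [set n | (0 < n)%N])
            (word_map phi (truncate omega n) @` X)).

(* Main.v *)
Require Import Defs.
From HB Require Import structures.
From mathcomp Require Import all_boot all_order all_algebra.
From mathcomp Require Import all_classical all_reals all_analysis.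
From mathcomp Require Import complex.
From mathcomp Require Import ring lra.
Set Implicit Arguments.
Unset Strict Implicit.
Unset Printing Implicit Defensive.
Import Order.TTheory GRing.Theory Num.Theory numFieldNormedType.Exports.
Local Open Scope classical_set_scope.
Local Open Scope ring_scope.

(** Write [f n] for the composite of the maps of [omega] at the levels below
    [j n].  The thinness of the limit set [J] at the projection [p] of [omega] is
    witnessed by the annuli [f n @` A n].

    Separation.  The point [p] lies in the image under [f n] of the piece
    [phi (j n) (m n) @` X], which [A n] surrounds.  By strong separation a point of
    [J] in [f n @` X] is the image of a point of the first level of the system at
    [j n], and [A n] misses that level; so [J] misses [f n @` A n].  Replacing the
    letter of [omega] at level [j n] by one whose piece lies outside [A n] gives a
    point of [J] on the other side.

    Size.  In the metric of the system the diameter of [f n @` X] decreases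
    geometrically.  On the compact set [X] that metric has the Euclidean topology,
    so a set that is small for it is small for the Euclidean metric as well, and
    the diameters of the images tend to 0.

    Modulus.  The map [f n] is holomorphic and injective near [A n] and so is its
    inverse; hence [A n] and its image have the same conformal maps onto round
    annuli, up to composition with [f n], and the same modulus.

    Two facts about the plane carry the argument.

    The inverse of an injective holomorphic map [f] is holomorphic
    ([inverse_holo]).  Differentiability being assumed only pointwise, the proof
    goes through Goursat's theorem on rectangles, Cauchy's formula on squares
    ([cauchy_formula]), a bound for the modulus at the centre of a square
    ([center_bound]) and the removability of an isolated singularity at which the
    function is continuous ([removable]).  Applied to [1 / (f - c)], the bound
    shows that [f] is open, so that its inverse [g] is continuous; applied to the
    quotients of [f - f a] by powers of [z - a], it shows that [f - f a] vanishes
    at [a] to a finite order.  Hence the zeros of the derivative are isolated.  So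
    [g] is continuous and holomorphic off isolated points, and these are
    removable.

    The image of a bounded topological annulus under such a map is again one
    ([annular_image]).  Let [D] be the annulus together with the bounded component
    of its complement; the point is that the complement of [f @` D] is connected.
    The boundary of [D] is connected, being the intersection of the closure of [D]
    and of its complement, two closed connected sets that cover the plane: the
    plane is unicoherent ([unicoherent]).  Its image is the boundary of [f @` D].
    A subset of the complement of [f @` D] that is open and closed in it and misses
    this boundary is open and closed in the plane, so it is empty; and a connected
    boundary cannot meet both parts of a separation. *)

(** * The modulus of complex numbers and continuity *)

Section Modulus.
Variable R : realType.
Implicit Types z w : R[i]^o.

(** Estimates take place in [R], where the order is total and the norm of
    [R[i]] has its values up to a coercion. *)
Definition absC (z : R[i]^o) : R := complex.Re `|z|.

Lemma absCE z : `|z| = (absC z)%:C%C.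
Proof. by rewrite /absC normc_def. Qed.

Lemma absC_ge0 z : 0 <= absC z.
Proof. by rewrite -lecR -absCE; exact: normr_ge0. Qed.

Lemma absC0 : absC 0 = 0.
Proof. by apply: complexI; rewrite -absCE normr0. Qed.

Lemma absC1 : absC 1 = 1.
Proof. by apply: complexI; rewrite -absCE normr1. Qed.

Lemma absC_eq0 z : (absC z == 0) = (z == 0).
Proof. by rewrite -(inj_eq (@complexI R)) -absCE normr_eq0. Qed.

Lemma absC_gt0 z : (0 < absC z) = (z != 0).
Proof. by rewrite lt_def absC_ge0 andbT absC_eq0. Qed.

Lemma absCM z w : absC (z * w) = absC z * absC w.
Proof. by apply: complexI; rewrite -absCE normrM !absCE rmorphM. Qed.

Lemma absCX z n : absC (z ^+ n) = absC z ^+ n.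
Proof. by elim: n => [|n IH]; rewrite ?absC1 // !exprS absCM IH. Qed.

Lemma absCN z : absC (- z) = absC z.
Proof. by apply: complexI; rewrite -absCE normrN. Qed.

Lemma absCV z : absC z^-1 = (absC z)^-1.
Proof. by apply: complexI; rewrite -absCE normfV fmorphV. Qed.

Lemma absC_distC z w : absC (z - w) = absC (w - z).
Proof. by rewrite -absCN opprB. Qed.

Lemma absCD z w : absC (z + w) <= absC z + absC w.
Proof. by rewrite -lecR rmorphD /= -!absCE ler_normD. Qed.

Lemma absCB z w : absC (z - w) <= absC z + absC w.
Proof. by rewrite -[absC w]absCN; exact: absCD. Qed.

Lemma absC_tri y z w : absC (z - w) <= absC (z - y) + absC (y - w).
Proof. by rewrite (le_trans _ (absCD _ _)) // addrA subrK. Qed.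

Lemma absC_dist z w : absC z - absC w <= absC (z - w).
Proof. by rewrite lerBlDr (le_trans _ (absCD _ _)) // subrK. Qed.

Lemma absC_real (x : R) : absC x%:C%C = `|x|.
Proof. by rewrite /absC normc_def /= expr0n /= addr0 sqrtr_sqr. Qed.

Lemma absC_i (x : R) : absC ('i%C * x%:C%C) = `|x|.
Proof.
rewrite absCM absC_real.
by rewrite /absC normc_def /= expr0n expr1n add0r sqrtr1 mul1r.
Qed.

Lemma absC_le_ReIm z : absC z <= `|complex.Re z| + `|complex.Im z|.
Proof.
by rewrite {1}(complexE z) (le_trans (absCD _ _)) // absC_i absC_real.
Qed.

Lemma Re_le_absC z : `|complex.Re z| <= absC z.
Proof.
rewrite /absC normc_def /= -sqrtr_sqr ler_wsqrtr // lerDl sqr_ge0 //.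
Qed.

Lemma Im_le_absC z : `|complex.Im z| <= absC z.
Proof.
rewrite /absC normc_def /= -sqrtr_sqr ler_wsqrtr // lerDr sqr_ge0 //.
Qed.

Lemma nbhsC z (P : set R[i]^o) :
  nbhs z P <-> exists2 e : R, 0 < e & forall w, absC (w - z) < e -> P w.
Proof.
rewrite nbhs_ballP; split => [[e /= e0 H]|[e e0 H]].
  have eE : e = (complex.Re e)%:C%C by rewrite RRe_real // gtr0_real.
  exists (complex.Re e); first by rewrite -ltcR -eE.
  move=> w wz; apply: H; rewrite -ball_normE /= distrC absCE eE ltcR //.
exists e%:C%C; first by rewrite /= ltcR.
by move=> w; rewrite -ball_normE /= distrC absCE ltcR; exact: H.
Qed.

Lemma cvgC (T : Type) (F : set_system T) {FF : Filter F} (f : T -> R[i]^o) z :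
  f @ F --> z <-> forall e : R, 0 < e -> \forall t \near F, absC (f t - z) < e.
Proof.
split=> [h e e0|h A /nbhsC[e e0 HA]].
  by apply: (h [set w | absC (w - z) < e]); apply/nbhsC; exists e.
by apply: filterS (h e e0) => t; exact: HA.
Qed.

Lemma cont_near (T : topologicalType) (f : T -> R[i]^o) t :
  {for t, continuous f} <-> forall e : R, 0 < e -> \forall s \near t,
    absC (f s - f t) < e.
Proof. exact: cvgC. Qed.

Lemma contR_near (T : topologicalType) (f : T -> R) t :
  {for t, continuous f} <-> forall e : R, 0 < e -> \forall s \near t, `|f t - f s| < e.
Proof. exact: cvgrPdist_lt. Qed.

Lemma contC (f : R[i]^o -> R[i]^o) z :
  {for z, continuous f} <-> forall e : R, 0 < e -> exists2 d : R, 0 < d &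
     forall w, absC (w - z) < d -> absC (f w - f z) < e.
Proof.
split=> [/cont_near h e e0|h].
  by have /nbhsC := h e e0.
by apply/cont_near => e e0; apply/nbhsC; exact: h.
Qed.

Lemma continuous_Re : continuous (@complex.Re R : R[i]^o -> R^o).
Proof.
move=> z; apply/contR_near => e e0; apply/nbhsC; exists e => // w wz.
by rewrite distrC; apply: le_lt_trans wz; rewrite -raddfB; exact: Re_le_absC.
Qed.

Lemma continuous_Im : continuous (@complex.Im R : R[i]^o -> R^o).
Proof.
move=> z; apply/contR_near => e e0; apply/nbhsC; exists e => // w wz.
by rewrite distrC; apply: le_lt_trans wz; rewrite -raddfB; exact: Im_le_absC.
Qed.

Lemma continuous_absC : continuous (absC : R[i]^o -> R^o).
Proof.
move=> z; apply/contR_near => e e0; apply/nbhsC; exists e => // w wz.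
rewrite ltr_norml; apply/andP; split.
  by rewrite ltrNl opprB (le_lt_trans (absC_dist _ _)).
by rewrite (le_lt_trans (absC_dist _ _)) // absC_distC.
Qed.

Lemma continuous_toC : continuous (fun x : R => x%:C%C : R[i]^o).
Proof.
move=> x; apply/cont_near => e e0.
have : \forall t \near x, `|x - t| < e.
  by have /cvgrPdist_lt := @cvg_id _ (nbhs (x : R^o)); apply.
by apply: filterS => t; rewrite -rmorphB absC_real distrC.
Qed.

Lemma continuous_Complex (T : topologicalType) (f g : T -> R) (t : T) :
  {for t, continuous f} -> {for t, continuous g} ->
  {for t, continuous (fun s => (f s +i* g s)%C : R[i]^o)}.
Proof.
move=> cf cg; apply/cont_near => e e0.
have e2 : 0 < e / 2 by rewrite divr_gt0.
have /contR_near /(_ _ e2) F := cf.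
have /contR_near /(_ _ e2) G := cg.
near=> s.
have -> : (f s +i* g s)%C - (f t +i* g t)%C = ((f s - f t) +i* (g s - g t))%C by [].
apply: le_lt_trans (absC_le_ReIm _) _ => /=.
rewrite [e](splitr e) ltrD // distrC; [near: s|near: s].
  exact: F.
exact: G.
Unshelve. all: by end_near. Qed.

Section ContinuityAlgebra.
Variables (T : topologicalType) (f g : T -> R[i]^o) (t : T).
Hypotheses (cf : {for t, continuous f}) (cg : {for t, continuous g}).

Lemma ctsD : {for t, continuous (fun s => f s + g s : R[i]^o)}.
Proof. by apply: cvgD; [exact: cf|exact: cg]. Qed.

Lemma ctsN : {for t, continuous (fun s => - f s : R[i]^o)}.
Proof. by apply: cvgN; exact: cf. Qed.

Lemma ctsB : {for t, continuous (fun s => f s - g s : R[i]^o)}.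
Proof. by apply: cvgB; [exact: cf|exact: cg]. Qed.

Lemma ctsM : {for t, continuous (fun s => f s * g s : R[i]^o)}.
Proof. by apply: cvgM; [exact: cf|exact: cg]. Qed.

Lemma ctsV : f t != 0 -> {for t, continuous (fun s => (f s)^-1 : R[i]^o)}.
Proof. by move=> ft0; apply: cvgV; [exact: ft0|exact: cf]. Qed.

End ContinuityAlgebra.

Lemma cts_cst (T : topologicalType) (k : R[i]^o)
  (t : T) : {for t, continuous (fun=> k)}.
Proof. exact: cst_continuous. Qed.

Lemma cts_id z : {for z, continuous (fun w : R[i]^o => w)}.
Proof. exact: cvg_id. Qed.

Lemma cts_comp (T : topologicalType) (f : T -> R[i]^o) (g : R[i]^o -> R[i]^o) (t : T) :
  {for t, continuous f} -> {for f t, continuous g} ->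
    {for t, continuous (fun s => g (f s))}.
Proof. exact: continuous_comp. Qed.

End Modulus.

Arguments cts_cst {R T} k t _ _.
Arguments cts_id {R} z _ _.

(** * Integrals of complex functions on segments *)

Section Integral.
Variable R : realType.
Implicit Types (a b c : R) (f g : R -> R).

Definition rint a b f : R := \int[lebesgue_measure]_(t in `[a, b]) f t.

(** Continuity is asked in the ambient space, not relatively to the segment:
    all integrands below are continuous near the segments of integration. *)
Definition continuous_itv (T : topologicalType) a b (f : R -> T) :=
  forall t, a <= t <= b -> {for t, continuous f}.

Lemma cts_integrable a b f : continuous_itv a b f ->
  lebesgue_measure.-integrable `[a, b] (EFin \o f).
Proof.
move=> cf; apply: continuous_compact_integrable; first exact: segment_compact.
by apply: continuous_in_subspaceT => x; rewrite inE /= in_itv /=; exact: cf.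
Qed.

Lemma rint_split a b c f : a <= b -> b <= c -> continuous_itv a c f ->
  rint a c f = rint a b f + rint b c f.
Proof.
move=> ab bc /cts_integrable If.
have I2 : lebesgue_measure.-integrable `]b, c] (EFin \o f).
  apply: (integrableS _ _ _ If) => //.
  by apply: subset_itvr; rewrite bnd_simp.
apply/eqP; rewrite addrC -subr_eq /rint Rintegral_itvB //.
by rewrite Rintegral_itv_obnd_cbnd.
Qed.

Lemma rintD a b f g : continuous_itv a b f -> continuous_itv a b g ->
  rint a b (fun t => f t + g t) = rint a b f + rint a b g.
Proof. by move=> /cts_integrable ? /cts_integrable ?; rewrite /rint RintegralD. Qed.

Lemma rintB a b f g : continuous_itv a b f -> continuous_itv a b g ->
  rint a b (fun t => f t - g t) = rint a b f - rint a b g.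
Proof. by move=> /cts_integrable ? /cts_integrable ?; rewrite /rint RintegralB. Qed.

Lemma rintZ a b (k : R) f : continuous_itv a b f ->
  rint a b (fun t => k * f t) = k * rint a b f.
Proof. by move=> /cts_integrable ?; rewrite /rint RintegralZl. Qed.

Lemma rint_cst a b k : a <= b -> rint a b (fun=> k) = k * (b - a).
Proof.
move=> ab; rewrite /rint Rintegral_cst //=; congr (_ * _).
rewrite lebesgue_measure_itv /= lte_fin.
move: ab; rewrite le_eqVlt => /predU1P[->|ab]; first by rewrite ltxx subrr.
by rewrite ab.
Qed.

Lemma le_rint a b f g : continuous_itv a b f -> continuous_itv a b g ->
  (forall t, a <= t <= b -> f t <= g t) -> rint a b f <= rint a b g.
Proof.
move=> cf cg fg; apply: le_Rintegral => //; try exact: cts_integrable.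
Qed.

Lemma rint_ge a b f k : a <= b -> continuous_itv a b f ->
  (forall t, a <= t <= b -> k <= f t) -> k * (b - a) <= rint a b f.
Proof.
by move=> ab cf kf; rewrite -rint_cst //; apply: le_rint => // t _;
  exact: cst_continuous.
Qed.

Lemma rint_le (a b : R) (f : R -> R) k : a <= b -> continuous_itv a b f ->
  (forall t, a <= t <= b -> f t <= k) -> rint a b f <= k * (b - a).
Proof.
move=> ab cf kf; rewrite -rint_cst //; apply: le_rint => //.
by move=> t _; exact: cst_continuous.
Qed.

Lemma rint_norm a b f k : a <= b -> continuous_itv a b f ->
  (forall t, a <= t <= b -> `|f t| <= k) -> `|rint a b f| <= k * (b - a).
Proof.
move=> ab cf kf; rewrite ler_norml -mulNr; apply/andP; split.
  by apply: rint_ge => // t /kf; rewrite ler_norml => /andP[].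
rewrite -rint_cst //; apply: le_rint => // [t _|t /kf].
  exact: cst_continuous.
by rewrite ler_norml => /andP[].
Qed.

Local Notation C := R[i]^o.

Definition cint a b (f : R -> C) : C :=
  (rint a b (fun t => complex.Re (f t)) +i* rint a b (fun t => complex.Im (f t)))%C.

Lemma cts_Re a b (f : R -> C) : continuous_itv a b f ->
  continuous_itv a b (fun t => complex.Re (f t)).
Proof.
move=> cf t /cf ct.
by apply: (@continuous_comp _ _ _ f (@complex.Re R : C -> R^o)) => //;
  exact: continuous_Re.
Qed.

Lemma cts_Im a b (f : R -> C) : continuous_itv a b f ->
  continuous_itv a b (fun t => complex.Im (f t)).
Proof.
move=> cf t /cf ct.
by apply: (@continuous_comp _ _ _ f (@complex.Im R : C -> R^o)) => //;
  exact: continuous_Im.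
Qed.

Hint Resolve cts_Re cts_Im : core.

Lemma cint_split a b c (f : R -> C) : a <= b -> b <= c -> continuous_itv a c f ->
  cint a c f = cint a b f + cint b c f.
Proof.
move=> ab bc cf; rewrite /cint (rint_split ab bc (cts_Re cf)).
by rewrite (rint_split ab bc (cts_Im cf)).
Qed.

Lemma eq_cint a b (f g : R -> C) : (forall t, a <= t <= b -> f t = g t) ->
  cint a b f = cint a b g.
Proof.
move=> fg; rewrite /cint /rint; congr (_ +i* _)%C; apply: eq_Rintegral => t;
  by rewrite inE /= in_itv /= => /fg ->.
Qed.

Lemma cintB a b (f g : R -> C) : continuous_itv a b f -> continuous_itv a b g ->
  cint a b (fun t => f t - g t) = cint a b f - cint a b g.
Proof.
move=> cf cg; rewrite /cint.
rewrite -[RHS]/((_ - _) +i* (_ - _))%C -!rintB; auto.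
by congr (_ +i* _)%C; congr rint; apply/funext => t; rewrite raddfB.
Qed.

Lemma cts_scale a b k f : continuous_itv a b f -> continuous_itv a b (fun t => k * f t).
Proof. by move=> cf t /cf ct; apply: cvgM => //; exact: cvg_cst. Qed.

Lemma cintZ a b (k : C) (f : R -> C) : continuous_itv a b f ->
  cint a b (fun t => k * f t) = k * cint a b f.
Proof.
move=> cf; rewrite /cint; case: k => x y.
rewrite -[RHS]/((_ - _) +i* (_ + _))%C -!rintZ; auto.
rewrite -rintB -?rintD; try by apply: cts_scale; auto.
by congr (_ +i* _)%C; congr rint; apply/funext => t; case: (f t).
Qed.

Lemma cint_cst a b (k : C) : a <= b -> cint a b (fun=> k) = k * (b - a)%:C%C.
Proof.
move=> ab; rewrite /cint !rint_cst //; case: k => x y /=.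
by rewrite -[RHS]/((_ - _) +i* (_ + _))%C !mulr0 subr0 add0r.
Qed.

(** Bounding the real and the imaginary parts separately costs the factor 2. *)
Lemma cint_norm a b (f : R -> C) k : a <= b -> continuous_itv a b f ->
  (forall t, a <= t <= b -> absC (f t) <= k) -> absC (cint a b f) <= 2 * k * (b - a).
Proof.
move=> ab cf kf; apply: le_trans (absC_le_ReIm _) _ => /=.
rewrite -mulrA mulr_natl mulr2n lerD //; apply: rint_norm => //; auto.
  by move=> t /kf; apply: le_trans; exact: Re_le_absC.
by move=> t /kf; apply: le_trans; exact: Im_le_absC.
Qed.

End Integral.

(** * Boundary integrals over rectangles and Goursat's theorem *)

Section Goursat.
Variable R : realType.
Local Notation C := R[i]^o.
Implicit Types (f g : C -> C) (x y : R).

Definition rect x0 x1 y0 y1 : set C :=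
  [set z | x0 <= complex.Re z <= x1 /\ y0 <= complex.Im z <= y1].

Definition continuous_pts (T U : topologicalType) (S : set T) (f : T -> U) :=
  forall z, S z -> {for z, continuous f}.

(** The integral of [f z dz] along the boundary of the rectangle,
    counterclockwise. *)
Definition rect_int f x0 x1 y0 y1 : C :=
  cint x0 x1 (fun x => f (x +i* y0)%C) - cint x0 x1 (fun x => f (x +i* y1)%C) +
  'i%C * (cint y0 y1 (fun y => f (x1 +i* y)%C) - cint y0 y1 (fun y => f (x0 +i* y)%C)).

Lemma cts_h f x0 x1 y0 y1 y : continuous_pts (rect x0 x1 y0 y1) f ->
  y0 <= y <= y1 -> continuous_itv x0 x1 (fun x => f (x +i* y)%C).
Proof.
move=> cf hy x hx; apply: (@continuous_comp _ _ _ (fun x : R => (x +i* y)%C : C) f).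
  by apply: continuous_Complex; [exact: cvg_id|exact: cvg_cst].
exact: cf.
Qed.

Lemma cts_v f x0 x1 y0 y1 x : continuous_pts (rect x0 x1 y0 y1) f ->
  x0 <= x <= x1 -> continuous_itv y0 y1 (fun y => f (x +i* y)%C).
Proof.
move=> cf hx y hy; apply: (@continuous_comp _ _ _ (fun y : R => (x +i* y)%C : C) f).
  by apply: continuous_Complex; [exact: cvg_cst|exact: cvg_id].
exact: cf.
Qed.

Lemma rect_int_splitx f x0 x1 x2 y0 y1 : x0 <= x1 -> x1 <= x2 -> y0 <= y1 ->
  continuous_pts (rect x0 x2 y0 y1) f ->
  rect_int f x0 x2 y0 y1 = rect_int f x0 x1 y0 y1 + rect_int f x1 x2 y0 y1.
Proof.
move=> x01 x12 y01 cf; rewrite /rect_int !(cint_split x01 x12).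
- by ring.
- by apply: (cts_h cf); rewrite lexx y01.
- by apply: (cts_h cf); rewrite lexx y01.
Qed.

Lemma rect_int_splity f x0 x1 y0 y1 y2 : y0 <= y1 -> y1 <= y2 -> x0 <= x1 ->
  continuous_pts (rect x0 x1 y0 y2) f ->
  rect_int f x0 x1 y0 y2 = rect_int f x0 x1 y0 y1 + rect_int f x0 x1 y1 y2.
Proof.
move=> y01 y12 x01 cf; rewrite /rect_int !(cint_split y01 y12).
- by ring.
- by apply: (cts_v cf); rewrite lexx x01.
- by apply: (cts_v cf); rewrite lexx x01.
Qed.

Definition rect_bd x0 x1 y0 y1 : set C := rect x0 x1 y0 y1 `&`
  [set z | [|| complex.Re z == x0, complex.Re z == x1, complex.Im z == y0 |
    complex.Im z == y1]].

Lemma rect_bd_rect x0 x1 y0 y1 : rect_bd x0 x1 y0 y1 `<=` rect x0 x1 y0 y1.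
Proof. by move=> z []. Qed.

Section edges.
Variables (x0 x1 y0 y1 : R).
Hypotheses (x01 : x0 <= x1) (y01 : y0 <= y1).

Lemma rect_bd_edges (P : C -> Prop) : (forall z, rect_bd x0 x1 y0 y1 z -> P z) ->
  [/\ forall t, x0 <= t <= x1 -> P (t +i* y0)%C,
      forall t, x0 <= t <= x1 -> P (t +i* y1)%C,
      forall t, y0 <= t <= y1 -> P (x0 +i* t)%C &
      forall t, y0 <= t <= y1 -> P (x1 +i* t)%C].
Proof.
by move=> HP; split=> t ht; apply: HP; (split; first split);
  rewrite /= ?ht ?lexx ?x01 ?y01 ?eqxx ?orbT.
Qed.

Lemma edge_cts f : continuous_pts (rect_bd x0 x1 y0 y1) f ->
  [/\ continuous_itv x0 x1 (fun x => f (x +i* y0)%C),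
   continuous_itv x0 x1 (fun x => f (x +i* y1)%C),
   continuous_itv y0 y1 (fun y => f (x0 +i* y)%C) &
   continuous_itv y0 y1 (fun y => f (x1 +i* y)%C)].
Proof.
move=> cf; have [c1 c2 c3 c4] := rect_bd_edges cf; split=> t ht.
- apply: (cts_comp (f := fun x : R => (x +i* y0)%C)); last exact: c1.
  by apply: continuous_Complex; [exact: cvg_id|exact: cvg_cst].
- apply: (cts_comp (f := fun x : R => (x +i* y1)%C)); last exact: c2.
  by apply: continuous_Complex; [exact: cvg_id|exact: cvg_cst].
- apply: (cts_comp (f := fun x : R => (x0 +i* x)%C)); last exact: c3.
  by apply: continuous_Complex; [exact: cvg_cst|exact: cvg_id].
- apply: (cts_comp (f := fun x : R => (x1 +i* x)%C)); last exact: c4.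
  by apply: continuous_Complex; [exact: cvg_cst|exact: cvg_id].
Qed.

Lemma eq_rect_int f g : (forall z, rect_bd x0 x1 y0 y1 z -> f z = g z) ->
  rect_int f x0 x1 y0 y1 = rect_int g x0 x1 y0 y1.
Proof.
move=> fg; have [e1 e2 e3 e4] := rect_bd_edges fg.
by rewrite /rect_int (eq_cint e1) (eq_cint e2) (eq_cint e3) (eq_cint e4).
Qed.

Lemma rect_int_B f g : continuous_pts (rect_bd x0 x1 y0 y1) f ->
  continuous_pts (rect_bd x0 x1 y0 y1) g ->
  rect_int (fun z => f z - g z) x0 x1 y0 y1
    = rect_int f x0 x1 y0 y1 - rect_int g x0 x1 y0 y1.
Proof.
move=> /edge_cts[? ? ? ?] /edge_cts[? ? ? ?].
by rewrite /rect_int !cintB //; ring.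
Qed.

Lemma rect_int_Z f (k : C) : continuous_pts (rect_bd x0 x1 y0 y1) f ->
  rect_int (fun z => k * f z) x0 x1 y0 y1 = k * rect_int f x0 x1 y0 y1.
Proof.
move=> /edge_cts[? ? ? ?].
by rewrite /rect_int !cintZ //; ring.
Qed.

(** Near a point of differentiability a function is affine up to a small
    error, so this leaves only the error to be bounded in [goursat]. *)
Lemma rect_int_affine (a b : C) : rect_int (fun z => a + b * z) x0 x1 y0 y1 = 0.
Proof.
have cf : continuous_pts (rect_bd x0 x1 y0 y1) (fun z : C => a + b * z).
  by move=> z _; apply: ctsD; [exact: cts_cst|apply: ctsM;
    [exact: cts_cst|exact: cts_id]].
have [? ? ? ?] := edge_cts cf.
rewrite /rect_int -!cintB //.
rewrite (@eq_cint _ _ _ _ (fun=> b * ('i%C * (y0 - y1)%:C%C))); last first.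
  move=> t _; rewrite opprD addrACA subrr add0r -mulrBr; congr (_ * _).
  by apply/eqP; rewrite eq_complex /=; apply/andP; split; apply/eqP; ring.
rewrite (@eq_cint _ y0 _ _ (fun=> b * (x1 - x0)%:C%C)); last first.
  move=> t _; rewrite opprD addrACA subrr add0r -mulrBr; congr (_ * _).
  by apply/eqP; rewrite eq_complex /=; apply/andP; split; apply/eqP; ring.
by rewrite !cint_cst // !rmorphB /=; ring.
Qed.

Lemma rect_int_norm f k : continuous_pts (rect_bd x0 x1 y0 y1) f ->
  (forall z, rect_bd x0 x1 y0 y1 z -> absC (f z) <= k) ->
  absC (rect_int f x0 x1 y0 y1) <= 4 * k * ((x1 - x0) + (y1 - y0)).
Proof.
move=> cf kf; have [c1 c2 c3 c4] := edge_cts cf; have [k1 k2 k3 k4] := rect_bd_edges kf.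
have -> : 4 * k * (x1 - x0 + (y1 - y0)) = (2 * k * (x1 - x0) + 2 * k * (x1 - x0)) +
   (2 * k * (y1 - y0) + 2 * k * (y1 - y0)) by ring.
apply: le_trans (absCD _ _) _; apply: lerD.
  by apply: le_trans (absCB _ _) _; apply: lerD;
    [apply: (cint_norm x01 c1)|apply: (cint_norm x01 c2)].
rewrite absCM (_ : absC 'i%C = 1) ?mul1r; last by have := absC_i (1 : R);
  rewrite mulr1 normr1.
by apply: le_trans (absCB _ _) _; apply: lerD;
  [apply: (cint_norm y01 c4)|apply: (cint_norm y01 c3)].
Qed.

Lemma rect_bd_bounded f : continuous_pts (rect_bd x0 x1 y0 y1) f ->
  exists2 k : R, 0 < k & forall z, rect_bd x0 x1 y0 y1 z -> absC (f z) <= k.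
Proof.
move=> /edge_cts[c1 c2 c3 c4].
have bnd a b (g : R -> C) : a <= b -> continuous_itv a b g ->
    exists k : R, forall t, a <= t <= b -> absC (g t) <= k.
  move=> ab cg; have cn : {within `[a, b], continuous (fun t => absC (g t) : R)}.
    apply: continuous_in_subspaceT => t; rewrite inE /= in_itv /= => ht.
    by apply: (@continuous_comp _ _ _ g (@absC R : C -> R^o));
      [exact: cg|exact: continuous_absC].
  have [c _ cmax] := EVT_max ab cn.
  by exists (absC (g c)) => t ht; apply: cmax; rewrite in_itv.
have [k1 h1] := bnd _ _ _ x01 c1; have [k2 h2] := bnd _ _ _ x01 c2.
have [k3 h3] := bnd _ _ _ y01 c3; have [k4 h4] := bnd _ _ _ y01 c4.
exists (`|k1| + `|k2| + `|k3| + `|k4| + 1); first by rewrite ltr_wpDl // !addr_ge0.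
move=> [x y] [[/= hx hy] /or4P[] /eqP e].
- have := h3 y hy; rewrite -e => /le_trans; apply; have := ler_norm k3.
  by have := normr_ge0 k1; have := normr_ge0 k2; have := normr_ge0 k4; lra.
- have := h4 y hy; rewrite -e => /le_trans; apply; have := ler_norm k4.
  by have := normr_ge0 k1; have := normr_ge0 k2; have := normr_ge0 k3; lra.
- have := h1 x hx; rewrite -e => /le_trans; apply; have := ler_norm k1.
  by have := normr_ge0 k3; have := normr_ge0 k2; have := normr_ge0 k4; lra.
- have := h2 x hx; rewrite -e => /le_trans; apply; have := ler_norm k2.
  by have := normr_ge0 k1; have := normr_ge0 k3; have := normr_ge0 k4; lra.
Qed.

End edges.

Lemma nested_intervals (a b : nat -> R) :
  (forall n, a n <= a n.+1) -> (forall n, b n.+1 <= b n) -> (forall n, a n <= b n) ->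
  exists p, forall n, a n <= p <= b n.
Proof.
move=> ha hb ab.
have am m n : (m <= n)%N -> a m <= a n by move/(homo_leq (@lexx _ R)
  (@le_trans _ R) ha).
have bm m n : (m <= n)%N -> b n <= b m.
  have tr : transitive (fun x y : R => y <= x) by move=> y x z ? h; exact: le_trans h _.
  by move/(homo_leq (@lexx _ R) tr hb).
have abmn m n : a m <= b n.
  by rewrite (le_trans (am _ _ (leq_maxl m n))) // (le_trans (ab _)) // bm // leq_maxr.
exists (sup (range a)) => n; apply/andP; split.
  by apply: ub_le_sup; [exists (b 0%N) => _ [m _ <-]|exists n].
by apply: ge_sup; [exists (a 0%N); exists 0%N|move=> _ [m _ <-]].
Qed.

(** Otherwise there are nested rectangles, each a quarter of the one before,
    on which [P] fails; they shrink to a point at which the last hypothesis is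
    contradicted. *)
Lemma rect_bisection (P : R -> R -> R -> R -> Prop) x0 x1 y0 y1 :
  x0 <= x1 -> y0 <= y1 ->
  (forall a b c d, a <= b -> c <= d -> let m := (a + b) / 2 in let n := (c + d) / 2 in
    rect a b c d `<=` rect x0 x1 y0 y1 ->
    P a m c n -> P m b c n -> P a m n d -> P m b n d -> P a b c d) ->
  (forall p, rect x0 x1 y0 y1 p -> exists2 e : R, 0 < e & forall a b c d, a <= b ->
    c <= d ->
     b - a < e -> d - c < e -> rect a b c d p -> 
     rect a b c d `<=` rect x0 x1 y0 y1 -> P a b c d) ->
  P x0 x1 y0 y1.
Proof.
move=> x01 y01 quarter small; apply: contrapT => nP.
(* The corner [u n] of the [n]-th rectangle is chosen below; its sides are
   [w n] and [h n]. *)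
pose w n : R := (x1 - x0) / 2 ^+ n; pose h n : R := (y1 - y0) / 2 ^+ n.
pose inside n (p : R * R) := 
  (x0 <= p.1 /\ p.1 + w n <= x1) /\ (y0 <= p.2 /\ p.2 + h n <= y1).
pose bad n (p : R * R) := inside n p /\ ~ P p.1 (p.1 + w n) p.2 (p.2 + h n).
have w_ge0 n : 0 <= w n by rewrite /w divr_ge0 ?subr_ge0 // exprn_ge0.
have h_ge0 n : 0 <= h n by rewrite /h divr_ge0 ?subr_ge0 // exprn_ge0.
have halve (x : R) n : x / 2 ^+ n = x / 2 ^+ n.+1 + x / 2 ^+ n.+1.
  by rewrite exprS invfM mulrA mulrAC [RHS](_ : _
    = x / 2 ^+ n * 2^-1 + x / 2 ^+ n * 2^-1) // -splitr.
have wS n : w n = w n.+1 + w n.+1 by exact: halve.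
have hS n : h n = h n.+1 + h n.+1 by exact: halve.
have step n p : bad n p -> exists2 q, bad n.+1 q &
   (p.1 <= q.1 /\ q.1 + w n.+1 <= p.1 + w n) /\ (p.2 <= q.2 /\
     q.2 + h n.+1 <= p.2 + h n).
  case: p => a c [[/= [ax bx] [cy dy]] nPp]; apply: contrapT => nq.
  have wn := w_ge0 n.+1; have hn := h_ge0 n.+1; have wE := wS n; have hE := hS n.
  have good u v : u = a \/ u = a + w n.+1 -> v = c \/ v = c + h n.+1 -> 
      P u (u + w n.+1) v (v + h n.+1).
    move=> hu hv; apply: contrapT => nPuv; apply: nq; exists (u, v) => /=.
      by split => //; split; split => /=; case: hu => hu; case: hv => hv; lra.
    by split; split; case: hu => hu; case: hv => hv; lra.
  have mE : (a + (a + w n)) / 2 = a + w n.+1 by lra.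
  have kE : (c + (c + h n)) / 2 = c + h n.+1 by lra.
  have wE' : a + w n = a + w n.+1 + w n.+1 by lra.
  have hE' : c + h n = c + h n.+1 + h n.+1 by lra.
  apply: nPp; apply: quarter; rewrite ?mE ?kE ?wE' ?hE'.
  - by lra.
  - by lra.
  - by move=> z [/andP[? ?] /andP[? ?]]; split; apply/andP; split; lra.
  - by apply: good; left.
  - by apply: good; [right|left].
  - by apply: good; [left|right].
  - by apply: good; right.
have bad0 : bad 0%N (x0, y0).
  split; first by rewrite /inside /= /w /h expr0 !divr1; split; split; lra.
  by rewrite /= /w /h expr0 !divr1 [x0 + _]addrC [y0 + _]addrC !subrK.
pose F n (s : {p | bad n p}) : {q | bad n.+1 q &
   ((sval s).1 <= q.1 /\ q.1 + w n.+1 <= (sval s).1 + w n) /\ 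
   ((sval s).2 <= q.2 /\ q.2 + h n.+1 <= (sval s).2 + h n)} := 
   cid2 (step n _ (svalP s)).
pose G := fix G n : {p | bad n p} := if n is k.+1 then 
   exist _ (s2val (F k (G k))) (s2valP (F k (G k))) else exist _ _ bad0.
pose u n := sval (G n).
have uS n : ((u n).1 <= (u n.+1).1 /\ (u n.+1).1 + w n.+1 <= (u n).1 + w n) /\ 
   ((u n).2 <= (u n.+1).2 /\ (u n.+1).2 + h n.+1 <= (u n).2 + h n).
  exact: (s2valP' (F n (G n))).
have ub n : bad n (u n) by exact: svalP.
have [p1 hp1] : exists p, forall n, (u n).1 <= p <= (u n).1 + w n.
  apply: nested_intervals => n; [by case: (uS n) => -[]|by case: (uS n) => -[]|].
  by rewrite lerDl.
have [p2 hp2] : exists p, forall n, (u n).2 <= p <= (u n).2 + h n.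
  apply: nested_intervals => n; [by case: (uS n) => _ []|by case: (uS n) => _ []|].
  by rewrite lerDl.
have sub n : rect (u n).1 ((u n).1 + w n) (u n).2 ((u n).2 + h n) `<=` rect x0 x1 y0 y1.
  have [[[? ?] [? ?]] _] := ub n.
  by move=> z [/andP[? ?] /andP[? ?]]; split; apply/andP; split; lra.
have [e e0 He] := small (p1 +i* p2)%C (sub 0%N (p1 +i* p2)%C (conj (hp1 0%N)
  (hp2 0%N))).
have lim0 (x : R) : 0 <= x -> \forall n \near \oo, x / 2 ^+ n < e.
  move=> x0'; have := @cvg_geometric R x (2^-1).
  rewrite ger0_norm ?invr_ge0 // invf_lt1 // ltr1n => /(_ isT).
  move=> /cvgrPdist_lt /(_ e e0); apply: filterS => n.
  rewrite sub0r normrN /geometric /= exprVn; apply: le_lt_trans; exact: ler_norm.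
have x10 : 0 <= x1 - x0 by rewrite subr_ge0.
have y10 : 0 <= y1 - y0 by rewrite subr_ge0.
have [n [wn hn]] : exists n, w n < e /\ h n < e.
  have : \forall n \near \oo, w n < e /\ h n < e.
    by apply: filterS2 (lim0 _ x10) (lim0 _ y10) => n.
  by case=> N _ /(_ N (leqnn N)); exists N.
have [_] := ub n; apply; apply: He => //.
- by rewrite lerDl.
- by rewrite lerDl.
- by rewrite addrC addKr.
- by rewrite addrC addKr.
Qed.

(** Caratheodory's form of complex differentiability: the difference quotient
    extends to a function [q] that is continuous at [z]. Products, composites
    and inverses are then differentiated without limits. See [derivable_holo]
    for the comparison with [derivable]. *)
Definition holo_at f (z : C) := exists2 q : C -> C,
  {for z, continuous q} & forall w, f w = f z + q w * (w - z).

Lemma holo_cts f z : holo_at f z -> {for z, continuous f}.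
Proof.
move=> [q cq fE].
have -> : f = (fun w => f z + q w * (w - z)) by apply/funext => w; exact: fE.
apply: ctsD; first exact: cts_cst.
apply: ctsM; first exact: cq.
by apply: ctsB; [exact: cts_id|exact: cts_cst].
Qed.

(** The bisected property bounds the integral by [e] times the square of the
    half perimeter: this square is divided by 4 when the sides are halved, so
    the bounds of the four quarters add up to that of the whole. *)
Lemma goursat f x0 x1 y0 y1 : x0 <= x1 -> y0 <= y1 ->
  (forall z, rect x0 x1 y0 y1 z -> holo_at f z) -> rect_int f x0 x1 y0 y1 = 0.
Proof.
move=> x01 y01 df.
have cf : continuous_pts (rect x0 x1 y0 y1) f by move=> z /df; exact: holo_cts.
have key (e : R) : 0 < e -> absC (rect_int f x0 x1 y0 y1) <= e * ((x1 - x0) +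
  (y1 - y0)) ^+ 2.
  move=> e0.
  apply: (@rect_bisection (fun a b c d =>
    absC (rect_int f a b c d) <= e * ((b - a) + (d - c)) ^+ 2)) => //.
    move=> a b c d ab cd m n sub.
    have cf' : continuous_pts (rect a b c d) f by move=> z /sub /cf.
    have am : a <= m by rewrite /m; lra.
    have mb : m <= b by rewrite /m; lra.
    have cn : c <= n by rewrite /n; lra.
    have nd : n <= d by rewrite /n; lra.
    have cl : continuous_pts (rect a m c d) f.
      by move=> z [/andP[? zm] ?]; apply: cf'; split=> //; apply/andP; split=> //;
        exact: le_trans mb.
    have cr : continuous_pts (rect m b c d) f.
      by move=> z [/andP[mz ?] ?]; apply: cf'; split=> //; apply/andP; split=> //;
        exact: le_trans mz.
    rewrite (rect_int_splitx am mb cd cf') (rect_int_splity cn nd am cl)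
      (rect_int_splity cn nd mb cr).
    move=> W1 W2 W3 W4.
    apply: (@le_trans _ _ (e * (m - a + (n - c)) ^+ 2 + e * (m - a + (d - n)) ^+ 2 +
       (e * (b - m + (n - c)) ^+ 2 + e * (b - m + (d - n)) ^+ 2))).
      apply: le_trans (absCD _ _) _; apply: lerD; apply: le_trans (absCD _ _) _;
        exact: lerD.
    rewrite -!mulrDr ler_pM2l // /m /n le_eqVlt; apply/orP; left; apply/eqP.
    by field.
  move=> p /df [q cq fE].
  have e4 : 0 < e / 4 by rewrite divr_gt0.
  have [d d0 Hd] := (contC q p).1 cq _ e4.
  exists (d / 2); first by rewrite divr_gt0.
  move=> a b c d' ab cd hb hd [/andP[pa pb] /andP[pc pd]] sub.
  have cf' : continuous_pts (rect a b c d') f by move=> z /sub /cf.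
  have cg : continuous_pts (rect a b c d') (fun z => f p - q p * p + q p * z).
    by move=> z _; apply: ctsD; [exact: cts_cst|apply: ctsM;
      [exact: cts_cst|exact: cts_id]].
  have cfb : continuous_pts (rect_bd a b c d') f by move=> z /rect_bd_rect; exact: cf'.
  have cgb : continuous_pts (rect_bd a b c d') (fun z => f p - q p * p + q p * z).
    by move=> z /rect_bd_rect; exact: cg.
  rewrite -[rect_int f _ _ _ _]subr0 -(rect_int_affine ab cd (f p - q p * p)
    (q p)) -(rect_int_B ab cd cfb cgb).
  set s := b - a + (d' - c).
  have s0 : 0 <= s by rewrite addr_ge0 // subr_ge0.
  have -> : e * s ^+ 2 = 4 * (e / 4 * s) * s by field.
  apply: (rect_int_norm ab cd).
    by move=> z /rect_bd_rect rz; apply: ctsB; [exact: cf'|exact: cg].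
  move=> z [[/andP[za zb] /andP[zc zd]] _].
  have -> : f z - (f p - q p * p + q p * z) = (q z - q p) * (z - p) by rewrite fE; ring.
  have zp : absC (z - p) <= s.
    apply: le_trans (absC_le_ReIm _) _; rewrite !raddfB /=; apply: lerD.
      by rewrite ler_norml; apply/andP; split; lra.
    by rewrite ler_norml; apply/andP; split; lra.
  rewrite absCM ler_pM ?absC_ge0 // ltW // Hd // (le_lt_trans zp) // /s.
  by rewrite (splitr d) ltrD.
apply/eqP; rewrite -absC_eq0 eq_le absC_ge0 andbT; apply/ler_addgt0Pl => e e0;
  rewrite addr0.
set S := ((x1 - x0) + (y1 - y0)) ^+ 2.
have S0 : 0 <= S by rewrite sqr_ge0.
have S1 : 0 < S + 1 by rewrite ltr_wpDl.
apply: le_trans (key (e / (S + 1)) _) _; first by rewrite divr_gt0.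
by rewrite -/S mulrAC ler_pdivrMr // ler_pM2l // lerDl.
Qed.

End Goursat.

(** * Complex differentiability and Cauchy's formula on squares *)

Section Cauchy.
Variable R : realType.
Local Notation C := R[i]^o.
Implicit Types (f g q : C -> C) (x y r : R) (z w a c : C).

Lemma cts_near_eq f g z (d : R) : 0 < d -> (forall w, absC (w - z) < d -> f w = g w) ->
  {for z, continuous f} -> {for z, continuous g}.
Proof.
move=> d0 fg /contC cf; apply/contC => e e0; have [d' d'0 Hd] := cf e e0.
exists (Num.min d d'); first by rewrite lt_min d0.
by move=> w; rewrite lt_min => /andP[wd wd']; rewrite -!fg ?subrr ?absC0 //; exact: Hd.
Qed.

(** The function [q] of [holo_at] is only needed near [z]; elsewhere it is the
    difference quotient. *)
Lemma holo_near f q z (d : R) : 0 < d -> {for z, continuous q} ->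
  (forall w, absC (w - z) < d -> f w = f z + q w * (w - z)) -> holo_at f z.
Proof.
move=> d0 cq fE.
exists (fun w => if w == z then q z else (f w - f z) / (w - z)).
  apply: (cts_near_eq d0 _ cq) => w wd; case: eqVneq => [->//|wz].
  by rewrite (fE w) // addrAC subrr add0r mulfK // subr_eq0.
move=> w; case: eqVneq => [->|wz]; first by rewrite subrr mulr0 addr0.
by rewrite divfK ?subr_eq0 // addrC subrK.
Qed.

Lemma holo_eq f g z (d : R) : 0 < d -> (forall w, absC (w - z) < d -> f w = g w) ->
  holo_at f z -> holo_at g z.
Proof.
move=> d0 fg [q cq fE]; apply: (holo_near d0 cq) => w wd.
by rewrite -!fg ?subrr ?absC0.
Qed.

Lemma holo_cst c z : holo_at (fun=> c) z.
Proof. by exists (fun=> 0); [exact: cts_cst|move=> w; rewrite mul0r addr0]. Qed.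

Lemma holo_id z : holo_at (fun w => w) z.
Proof. by exists (fun=> 1); [exact: cts_cst|move=> w; rewrite mul1r addrC subrK]. Qed.

Lemma holoB f g z : holo_at f z -> holo_at g z -> holo_at (fun w => f w - g w) z.
Proof.
move=> [q cq fE] [p cp gE]; exists (fun w => q w - p w); first exact: (ctsB cq cp).
by move=> w; rewrite fE gE; ring.
Qed.

Lemma holoM f g z : holo_at f z -> holo_at g z -> holo_at (fun w => f w * g w) z.
Proof.
move=> df dg; have cg := holo_cts dg; case: df dg => [q cq fE] [p cp gE].
exists (fun w => q w * g w + f z * p w).
  exact: (ctsD (ctsM cq cg) (ctsM (cts_cst (f z) z) cp)).
by move=> w; rewrite fE gE; ring.
Qed.

Lemma cts_neq0 f z : {for z, continuous f} -> f z != 0 ->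
  exists2 d : R, 0 < d & forall w, absC (w - z) < d -> f w != 0.
Proof.
rewrite -absC_gt0 => /contC cf fz0; have [d d0 Hd] := cf _ fz0; exists d => // w /Hd.
apply: contraTneq => ->; by rewrite sub0r absCN ltxx.
Qed.

Lemma holoV f z : holo_at f z -> f z != 0 -> holo_at (fun w => (f w)^-1) z.
Proof.
move=> df fz0; have cf := holo_cts df; have [d d0 Hd] := cts_neq0 cf fz0.
case: df => q cq fE.
apply: (@holo_near _ (fun w => - (q w * ((f w)^-1 * (f z)^-1))) _ d d0).
  apply: ctsN; apply: ctsM; first exact: cq.
  exact: (ctsM (ctsV cf fz0) (cts_cst ((f z)^-1 : C) z)).
move=> w /Hd fw0; have h : q w * (w - z) = f w - f z by rewrite
  (fE w) addrAC subrr add0r.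
by rewrite mulNr mulrAC h; field; rewrite fw0 fz0.
Qed.

Lemma holo_comp f g z : holo_at f z -> holo_at g (f z) -> holo_at (fun w => g (f w)) z.
Proof.
move=> df; have cf := holo_cts df; case: df => [q cq fE] [p cp gE].
exists (fun w => p (f w) * q w).
  exact: (ctsM (cts_comp cf cp) cq).
move=> w; have h : f w - f z = q w * (w - z) by rewrite (fE w) addrAC subrr add0r.
by rewrite gE h mulrA.
Qed.

Definition sq a r := rect (complex.Re a - r) (complex.Re a + r) (complex.Im a - r)
  (complex.Im a + r).
Definition sq_bd a r := rect_bd (complex.Re a - r) (complex.Re a + r)
  (complex.Im a - r) (complex.Im a + r).
Definition sq_int f a r := rect_int f (complex.Re a - r) (complex.Re a + r)
  (complex.Im a - r) (complex.Im a + r).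

Lemma sq_bd_sq a r : sq_bd a r `<=` sq a r.
Proof. exact: rect_bd_rect. Qed.

Lemma sq_absC a r z : sq a r z -> absC (z - a) <= r + r.
Proof.
move=> [/andP[? ?] /andP[? ?]]; apply: le_trans (absC_le_ReIm _) _; rewrite !raddfB /=.
by apply: lerD; rewrite ler_norml; apply/andP; split; lra.
Qed.

Lemma absC_sq a r z : absC (z - a) <= r -> sq a r z.
Proof.
move=> h; have := le_trans (Re_le_absC _) h; have := le_trans (Im_le_absC _) h.
rewrite !raddfB /= !ler_norml => /andP[? ?] /andP[? ?].
by split; apply/andP; split; lra.
Qed.

Lemma sqbd_absC a r z : 0 < r -> sq_bd a r z -> r <= absC (z - a).
Proof.
move=> r0 [_ /or4P[] /eqP h].
- apply: le_trans (Re_le_absC _); rewrite raddfB /= h addrAC subrr add0r normrN.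
  exact: ler_norm.
- apply: le_trans (Re_le_absC _); rewrite raddfB /= h addrAC subrr add0r.
  exact: ler_norm.
- apply: le_trans (Im_le_absC _); rewrite raddfB /= h addrAC subrr add0r normrN.
  exact: ler_norm.
- apply: le_trans (Im_le_absC _); rewrite raddfB /= h addrAC subrr add0r.
  exact: ler_norm.
Qed.

Section square.
Variables (a : C) (r : R).
Hypothesis r0 : 0 < r.

Let xr : complex.Re a - r <= complex.Re a + r. Proof.
  by rewrite lerD2l ge0_cp // ltW. Qed.
Let yr : complex.Im a - r <= complex.Im a + r. Proof.
  by rewrite lerD2l ge0_cp // ltW. Qed.

Lemma sq_int_norm f k : continuous_pts (sq_bd a r) f ->
  (forall z, sq_bd a r z -> absC (f z) <= k) -> absC (sq_int f a r) <= 16 * k * r.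
Proof.
move=> cf kf; apply: le_trans (rect_int_norm xr yr cf kf) _.
by rewrite le_eqVlt; apply/orP; left; apply/eqP; ring.
Qed.

Lemma sq_int_B f g : continuous_pts (sq_bd a r) f -> continuous_pts (sq_bd a r) g ->
  sq_int (fun z => f z - g z) a r = sq_int f a r - sq_int g a r.
Proof. exact: rect_int_B. Qed.

Lemma sq_int_Z f c : continuous_pts (sq_bd a r) f ->
  sq_int (fun z => c * f z) a r = c * sq_int f a r.
Proof. exact: rect_int_Z. Qed.

Lemma eq_sq_int f g : (forall z, sq_bd a r z -> f z = g z) ->
  sq_int f a r = sq_int g a r.
Proof. exact: eq_rect_int. Qed.

End square.

(** Cutting along the sides of a small square centred at [p] leaves rectangles
    that avoid [p], so the integral is that over the small square. This is at
    most a multiple of the side, since [f] is bounded near [p]. *)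
Lemma goursat_except f x0 x1 y0 y1 p :
  x0 < complex.Re p < x1 -> y0 < complex.Im p < y1 ->
  (forall z, rect x0 x1 y0 y1 z -> z != p -> holo_at f z) ->
  {for p, continuous f} -> rect_int f x0 x1 y0 y1 = 0.
Proof.
move=> /andP[px0 px1] /andP[py0 py1] df cp.
have cf : continuous_pts (rect x0 x1 y0 y1) f.
  by move=> z rz; case: (eqVneq z p) => [->//|zp]; apply: holo_cts; exact: df.
(* The distance from [p] to the boundary, in the maximum norm. *)
have [m m0 [m1 m2 m3 m4]] : exists2 m : R, 0 < m & [/\ m <= complex.Re p - x0,
    m <= x1 - complex.Re p, m <= complex.Im p - y0 & m <= y1 - complex.Im p].
  exists (Num.min (Num.min (complex.Re p - x0) (x1 - complex.Re p))
                  (Num.min (complex.Im p - y0) (y1 - complex.Im p))).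
    by rewrite !lt_min !subr_gt0 px0 px1 py0.
  by split; rewrite !ge_min lexx ?orbT.
have shrink e : 0 < e -> e <= m -> rect_int f x0 x1 y0 y1 = sq_int f p e.
  move=> e0 em.
  have a1 : x0 <= complex.Re p - e by lra.
  have a2 : complex.Re p - e <= complex.Re p + e by lra.
  have a3 : complex.Re p + e <= x1 by lra.
  have b1 : y0 <= complex.Im p - e by lra.
  have b2 : complex.Im p - e <= complex.Im p + e by lra.
  have b3 : complex.Im p + e <= y1 by lra.
  have y01 : y0 <= y1 by lra.
  have sub u v s t : x0 <= u -> v <= x1 -> y0 <= s -> t <= y1 ->
      rect u v s t `<=` rect x0 x1 y0 y1.
    move=> ? ? ? ? z [/andP[? ?] /andP[? ?]].
    by split; apply/andP; split; apply: le_trans; eassumption.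
  have csub u v s t : x0 <= u -> v <= x1 -> y0 <= s -> t <= y1 ->
      continuous_pts (rect u v s t) f.
    by move=> ? ? ? ? z rz; apply: cf; apply: sub rz.
  have good u v s t : u <= v -> s <= t -> x0 <= u -> v <= x1 -> y0 <= s -> t <= y1 ->
      ~ rect u v s t p -> rect_int f u v s t = 0.
    move=> uv st ? ? ? ? np; apply: goursat => // z rz; apply: df; first exact: sub rz.
    by apply: contra_notN np => /eqP <-.
  have a12 := le_trans a1 a2; have a23 := le_trans a2 a3.
  have b12 := le_trans b1 b2; have b23 := le_trans b2 b3.
  rewrite (rect_int_splitx (le_trans a1 a2) a3 y01 cf).
  rewrite (rect_int_splitx a1 a2 y01); last by apply: csub.
  rewrite (good _ _ _ _ a1 y01) //; last by move=> [/andP[_ ?] _]; lra.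
  rewrite (good _ _ _ _ a3 y01) //; last by move=> [/andP[? _] _]; lra.
  rewrite (rect_int_splity b12 b3 a2); last by apply: csub.
  rewrite (rect_int_splity b1 b2 a2); last by apply: csub.
  rewrite (good _ _ _ _ a2 b1) //; last by move=> [_ /andP[_ ?]]; lra.
  rewrite (good _ _ _ _ a2 b3) //; last by move=> [_ /andP[? _]]; lra.
  by rewrite !add0r !addr0.
have [d d0 Hd] := (contC f p).1 cp 1 ltr01.
apply/eqP; rewrite -absC_eq0 eq_le absC_ge0 andbT; apply/ler_addgt0Pl => e e0;
  rewrite addr0.
pose k := absC (f p) + 1.
have k0 : 0 < k by rewrite ltr_wpDl ?absC_ge0.
(* With half side [t] the small square lies in the rectangle and [f] is
   bounded by [k] on it, so that the integral is at most [16 * k * t]. *)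
pose t := Num.min (Num.min m (d / 4)) (e / (16 * k)).
have t0 : 0 < t by rewrite !lt_min m0 !divr_gt0 //= mulr_gt0.
rewrite (shrink t t0); last by rewrite !ge_min lexx.
have td : t <= d / 4 by rewrite !ge_min lexx orbT.
have te : t <= e / (16 * k) by rewrite !ge_min lexx orbT.
have near z : sq p t z -> absC (f z) <= k.
  move=> /sq_absC zt; have /Hd h : absC (z - p) < d by lra.
  by have := absC_dist (f z) (f p); rewrite /k; lra.
apply: le_trans (sq_int_norm t0 (k := k) _ _) _.
- have tm : t <= m by rewrite !ge_min lexx.
  move=> z /sq_bd_sq [/andP[? ?] /andP[? ?]]; apply: cf.
  by split; apply/andP; split; lra.
- by move=> z /sq_bd_sq/near.
by rewrite mulrC -ler_pdivlMr // mulr_gt0.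
Qed.

Section CauchyFormula.
Variables (a : C) (r : R).
Hypothesis r0 : 0 < r.

Let xr : complex.Re a - r <= complex.Re a + r. Proof.
  by rewrite lerD2l ge0_cp // ltW. Qed.
Let yr : complex.Im a - r <= complex.Im a + r. Proof.
  by rewrite lerD2l ge0_cp // ltW. Qed.

Definition cauchy_kernel z : C -> C := fun w => (w - z)^-1.

(** Cauchy's integral without its factor [1 / (2 i pi)]; in [cauchy_formula]
    the integral [winding] of the kernel stands for [2 i pi]. *)
Definition cauchy_int g z : C := sq_int (fun w => g w * cauchy_kernel z w) a r.

Definition winding z : C := sq_int (cauchy_kernel z) a r.

Lemma sq_bd_far d z w : absC (z - a) <= r - d -> sq_bd a r w -> d <= absC (w - z).
Proof.
move=> za /(sqbd_absC r0) wa; have := absC_tri z w a; lra.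
Qed.

Lemma sq_bd_neq z w : absC (z - a) < r -> sq_bd a r w -> w - z != 0.
Proof.
move=> za /(sqbd_absC r0) wa; apply: contraTneq za => /eqP; rewrite subr_eq0 => /eqP <-.
by rewrite -leNgt.
Qed.

Lemma cts_kernel z w : w - z != 0 -> {for w, continuous (cauchy_kernel z)}.
Proof. by move=> wz; exact: (ctsV (ctsB (cts_id w) (cts_cst z w)) wz). Qed.

Lemma cts_sq_bd_kernel g z : absC (z - a) < r -> continuous_pts (sq_bd a r) g ->
  continuous_pts (sq_bd a r) (fun w => g w * cauchy_kernel z w).
Proof.
move=> za cg w bw; exact: (ctsM (cg w bw) (cts_kernel (sq_bd_neq za bw))).
Qed.

(** The difference quotient of [f] at [z] is continuous at [z] and holomorphic
    elsewhere, so its integral vanishes by [goursat_except]. *)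
Lemma cauchy_formula f z : (forall w, sq a r w -> holo_at f w) -> absC (z - a) < r ->
  cauchy_int f z = f z * winding z.
Proof.
move=> df za; have [q cq fE] := df z (absC_sq (ltW za)).
have qE w : w != z -> q w = (f w - f z) * cauchy_kernel z w.
  by move=> wz; rewrite (fE w) addrAC subrr add0r mulfK // subr_eq0.
have cbk : continuous_pts (sq_bd a r) (cauchy_kernel z).
  by move=> w bw; exact: (cts_kernel (sq_bd_neq za bw)).
have cf : continuous_pts (sq_bd a r) f by move=> w /sq_bd_sq /df; exact: holo_cts.
have : sq_int q a r = 0.
  have := Re_le_absC (z - a); have := Im_le_absC (z - a); rewrite !raddfB /= => h1 h2.
  have := le_lt_trans h1 za; have := le_lt_trans h2 za.
  rewrite !ltr_norml => /andP[? ?] /andP[? ?].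
  apply: (goursat_except (p := z)); [by apply/andP; split; lra|by apply/andP; split;
    lra| |exact: cq].
  move=> w rw wz.
  have wz0 : w - z != 0 by rewrite subr_eq0.
  have cd : holo_at (fun w => (f w - f z) * cauchy_kernel z w) w.
    apply: holoM; first by apply: holoB; [exact: df|exact: holo_cst].
    by apply: holoV => //; apply: holoB; [exact: holo_id|exact: holo_cst].
  apply: (holo_eq (d := absC (w - z)) _ _ cd); first by rewrite absC_gt0.
  move=> v vw; rewrite qE //; apply: contraTneq vw => ->.
  by rewrite -leNgt absC_distC.
have -> : sq_int q a r = sq_int (fun w =>
  f w * cauchy_kernel z w - f z * cauchy_kernel z w) a r.
  apply: (eq_sq_int r0) => w /(sq_bd_neq za) wz; rewrite qE ?mulrBl //.
  by rewrite -subr_eq0.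
rewrite (sq_int_B r0); last 2 first.
- exact: cts_sq_bd_kernel.
- by move=> w bw; exact: (ctsM (cts_cst (f z) w) (cbk w bw)).
by rewrite (sq_int_Z r0) // => /eqP; rewrite subr_eq0 => /eqP.
Qed.

Let za0 : absC (a - a) < r. Proof. by rewrite subrr absC0. Qed.

(** The difference quotient of a Cauchy integral at the centre is again a
    Cauchy integral. As Cauchy integrals are bounded near the centre, they are
    continuous there, and then differentiable. *)
Lemma cauchy_int_diff g z : absC (z - a) < r -> continuous_pts (sq_bd a r) g ->
  cauchy_int g z = cauchy_int g a + cauchy_int (fun w =>
    g w * cauchy_kernel a w) z * (z - a).
Proof.
move=> za cg; apply/eqP; rewrite addrC -subr_eq; apply/eqP.
have cga := cts_sq_bd_kernel za0 cg.
rewrite /cauchy_int -(sq_int_B r0); [|exact: cts_sq_bd_kernel|exact: cga].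
rewrite [RHS]mulrC -(sq_int_Z r0); last exact: cts_sq_bd_kernel.
apply: (eq_sq_int r0) => w bw; rewrite /cauchy_kernel.
have h1 := sq_bd_neq za bw; have h2 := sq_bd_neq za0 bw.
by field; rewrite h1 h2.
Qed.

Lemma cauchy_int_bound g k z : (forall w, sq_bd a r w -> absC (g w) <= k) ->
  continuous_pts (sq_bd a r) g -> absC (z - a) <= r / 2 ->
    absC (cauchy_int g z) <= 32 * k.
Proof.
have rp := r0; move=> gk cg za; have za' : absC (z - a) < r by lra.
have -> : 32 * k = 16 * (k * (2 / r)) * r by field; rewrite gt_eqF.
apply: (sq_int_norm r0); first exact: cts_sq_bd_kernel.
move=> w bw; rewrite absCM ler_pM ?absC_ge0 ?gk // absCV.
have h : r / 2 <= absC (w - z) by apply: sq_bd_far bw; lra.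
by rewrite -[2 / r]invf_div lef_pV2 // posrE; lra.
Qed.

Lemma cauchy_int_cts g : continuous_pts (sq_bd a r) g ->
  {for a, continuous (cauchy_int g)}.
Proof.
have rp := r0; move=> cg; apply/contC => e e0.
have cga := cts_sq_bd_kernel za0 cg.
have [k k0 Hk] := rect_bd_bounded xr yr cga.
have d0 : 0 < Num.min (r / 2) (e / (32 * k)) by rewrite lt_min !divr_gt0 // mulr_gt0.
exists (Num.min (r / 2) (e / (32 * k))) => // z; rewrite lt_min => /andP[zr ze].
have za : absC (z - a) < r by lra.
rewrite (cauchy_int_diff za cg) addrAC subrr add0r absCM mulrC.
have h := cauchy_int_bound Hk cga (ltW zr).
have [->|z0] := eqVneq (absC (z - a)) 0; first by rewrite mul0r.
have zp : 0 < absC (z - a) by rewrite lt_def z0 absC_ge0.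
apply: le_lt_trans (_ : absC (z - a) * (32 * k) < e); first by rewrite ler_pM2l.
by rewrite -ltr_pdivlMr // mulr_gt0.
Qed.

Lemma cauchy_int_holo g : continuous_pts (sq_bd a r) g -> holo_at (cauchy_int g) a.
Proof.
move=> cg; apply: (holo_near r0 (cauchy_int_cts (cts_sq_bd_kernel za0 cg))).
by move=> z za; exact: cauchy_int_diff.
Qed.

Lemma windingE z : winding z = cauchy_int (fun=> 1) z.
Proof. by apply: (eq_sq_int r0) => w _; rewrite mul1r. Qed.

Lemma cts_sq_bd_cst1 : continuous_pts (sq_bd a r) (fun=> 1 : C).
Proof. by move=> w _; exact: cts_cst. Qed.

Lemma winding_holo : holo_at winding a.
Proof.
have -> : winding = cauchy_int (fun=> 1) by apply/funext => z; exact: windingE.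
exact: (cauchy_int_holo cts_sq_bd_cst1).
Qed.

End CauchyFormula.

End Cauchy.

(** * Bounds, removable singularities and open images *)

Section Consequences.
Variable R : realType.
Local Notation C := R[i]^o.
Implicit Types (f g q : C -> C) (x y r : R) (z w a c : C).

Lemma ReV z : complex.Re z^-1 = complex.Re z / (complex.Re z ^+ 2 + complex.Im z ^+ 2).
Proof. by case: z. Qed.

Lemma ImV z : complex.Im z^-1 = - (complex.Im z /
  (complex.Re z ^+ 2 + complex.Im z ^+ 2)).
Proof. by case: z. Qed.

(** The integrand of the imaginary part of [winding] on each side of the
    square, bounded below by its value at the corners. *)
Lemma angular_density (r x : R) : 0 < r -> - r <= x <= r ->
  (r + r)^-1 <= r / (x ^+ 2 + r ^+ 2).
Proof.
move=> r0 /andP[x1 x2].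
have rr : 0 < r ^+ 2 by rewrite exprn_gt0.
have x2r2 : x ^+ 2 <= r ^+ 2.
  by rewrite -subr_ge0 subr_sqr mulr_ge0 //; lra.
rewrite ler_pdivlMr; last by rewrite ltr_wpDl // sqr_ge0.
rewrite mulrC ler_pdivrMr ?addr_gt0 //.
by rewrite mulrDr -!expr2 lerD2r.
Qed.

(** The value is [2 i pi]; the bound says that each side contributes at least
    1 to the imaginary part, which avoids any primitive. *)
Lemma winding_center a r : 0 < r -> 4 <= complex.Im (winding a r a).
Proof.
move=> r0.
set x0 := complex.Re a - r; set x1 := complex.Re a + r.
set y0 := complex.Im a - r; set y1 := complex.Im a + r.
have x01 : x0 <= x1 by rewrite /x0 /x1; lra.
have y01 : y0 <= y1 by rewrite /y0 /y1; lra.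
have za : absC (a - a) < r by rewrite subrr absC0.
have ck : continuous_pts (rect_bd x0 x1 y0 y1) (cauchy_kernel a).
  by move=> w bw; exact: (cts_kernel (sq_bd_neq r0 za bw)).
have [c1 c2 c3 c4] := edge_cts x01 y01 ck.
have -> : complex.Im (winding a r a) = 
    rint x0 x1 (fun t => complex.Im (cauchy_kernel a (t +i* y0)%C)) -
    rint x0 x1 (fun t => complex.Im (cauchy_kernel a (t +i* y1)%C)) +
    (rint y0 y1 (fun t => complex.Re (cauchy_kernel a (x1 +i* t)%C)) -
    rint y0 y1 (fun t => complex.Re (cauchy_kernel a (x0 +i* t)%C))).
  by rewrite /winding /sq_int /rect_int /cint /= mul0r mul1r add0r.
have one : (r + r)^-1 * (r + r) = 1 by rewrite mulVf // gt_eqF // addr_gt0.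
have h1 : 1 <= rint x0 x1 (fun t => complex.Im (cauchy_kernel a (t +i* y0)%C)).
  have -> : 1 = (r + r)^-1 * (x1 - x0) by rewrite -one /x0 /x1; congr (_ * _); ring.
  apply: (rint_ge x01 (cts_Im c1)) => t /andP[t0 t1].
  rewrite /cauchy_kernel ImV !raddfB /= /y0 addrAC subrr add0r sqrrN mulNr opprK.
  by apply: angular_density => //; apply/andP; split; move: t0 t1; rewrite /x0 /x1; lra.
have h2 : rint x0 x1 (fun t => complex.Im (cauchy_kernel a (t +i* y1)%C)) <= -1.
  have -> : -1 = (- (r + r)^-1) * (x1 - x0) by rewrite -one -mulNr /x0 /x1;
    congr (_ * _); ring.
  apply: (rint_le x01 (cts_Im c2)) => t /andP[t0 t1].
  rewrite /cauchy_kernel ImV !raddfB /= /y1 addrAC subrr add0r lerN2.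
  by apply: angular_density => //; apply/andP; split; move: t0 t1; rewrite /x0 /x1; lra.
have h3 : 1 <= rint y0 y1 (fun t => complex.Re (cauchy_kernel a (x1 +i* t)%C)).
  have -> : 1 = (r + r)^-1 * (y1 - y0) by rewrite -one /y0 /y1; congr (_ * _); ring.
  apply: (rint_ge y01 (cts_Re c4)) => t /andP[t0 t1].
  rewrite /cauchy_kernel ReV !raddfB /= /x1 addrAC subrr add0r [r ^+ 2 + _]addrC.
  by apply: angular_density => //; apply/andP; split; move: t0 t1; rewrite /y0 /y1; lra.
have h4 : rint y0 y1 (fun t => complex.Re (cauchy_kernel a (x0 +i* t)%C)) <= -1.
  have -> : -1 = (- (r + r)^-1) * (y1 - y0) by rewrite -one -mulNr /y0 /y1;
    congr (_ * _); ring.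
  apply: (rint_le y01 (cts_Re c3)) => t /andP[t0 t1].
  rewrite /cauchy_kernel ReV !raddfB /= /x0 addrAC subrr add0r sqrrN mulNr lerN2 [r ^+
    2 + _]addrC.
  by apply: angular_density => //; apply/andP; split; move: t0 t1; rewrite /y0 /y1; lra.
lra.
Qed.

Lemma winding_ge4 a r : 0 < r -> 4 <= absC (winding a r a).
Proof.
move=> r0; apply: le_trans (winding_center a r0) _; apply: le_trans (Im_le_absC _).
exact: ler_norm.
Qed.

Lemma winding_neq0 a r : 0 < r -> winding a r a != 0.
Proof. by move=> r0; rewrite -absC_gt0 (lt_le_trans _ (winding_ge4 a r0)). Qed.

(** A maximum principle at the centre of a square, where the optimal constant
    1 is replaced by the constant 8 that comes from [cauchy_int_bound] and
    [winding_ge4]. *)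
Lemma center_bound f a r k : 0 < r -> (forall w, sq a r w -> holo_at f w) ->
  (forall w, sq_bd a r w -> absC (f w) <= k) -> absC (f a) <= 8 * k.
Proof.
move=> r0 df fk.
have za : absC (a - a) < r by rewrite subrr absC0.
have za2 : absC (a - a) <= r / 2 by rewrite subrr absC0 divr_ge0 // ltW.
have cf : continuous_pts (sq_bd a r) f by move=> w /sq_bd_sq /df; exact: holo_cts.
have := cauchy_int_bound r0 fk cf za2.
rewrite (cauchy_formula r0 df za) absCM => h.
have := winding_ge4 a r0; have := absC_ge0 (f a) => h1 h2.
have : absC (f a) * 4 <= absC (f a) * absC (winding a r a) by rewrite ler_wpM2l.
lra.
Qed.

Lemma cts_punctured_eq f g a (d : R) : 0 < d -> {for a, continuous f} ->
  {for a, continuous g} ->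
  (forall z, absC (z - a) < d -> z != a -> f z = g z) -> f a = g a.
Proof.
move=> d0 /contC cf /contC cg fg; apply/eqP;
  rewrite -subr_eq0 -absC_eq0 eq_le absC_ge0 andbT.
apply/ler_addgt0Pl => e e0; rewrite addr0.
have e2 : 0 < e / 2 by rewrite divr_gt0.
have [d1 d10 H1] := cf _ e2; have [d2 d20 H2] := cg _ e2.
pose t := Num.min d (Num.min d1 d2) / 2.
have t0 : 0 < t by rewrite divr_gt0 // !lt_min d0 d10.
pose z : C := a + t%:C%C.
have zt : absC (z - a) = t by rewrite /z addrAC subrr add0r absC_real gtr0_norm.
have tm : t < Num.min d (Num.min d1 d2).
  by rewrite /t ltr_pdivrMr // mulr_natr mulr2n ltrDl !lt_min d0 d10.
move: tm; rewrite !lt_min => /and3P[td t1 t2].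
have za : z != a by rewrite -subr_eq0 -absC_eq0 zt gt_eqF.
have := H1 z; have := H2 z; rewrite zt fg ?zt // => /(_ t2) h2 /(_ t1) h1.
apply: le_trans (absC_tri (g z) _ _) _; rewrite absC_distC; lra.
Qed.

(** The product [F] of [f] and [w - a] is holomorphic at [a] as well.
    Subtracting Cauchy's formulas of [F] at [z] and at its zero [a], and
    dividing by [z - a], gives Cauchy's formula for [f] off [a], and by
    continuity at [a]. So [f] is near [a] a quotient of two Cauchy integrals. *)
Lemma removable f a r : 0 < r -> (forall w, sq a r w -> w != a -> holo_at f w) ->
  {for a, continuous f} -> holo_at f a.
Proof.
move=> r0 df ca.
have za : absC (a - a) < r by rewrite subrr absC0.
have cf : continuous_pts (sq_bd a r) f.
  move=> w bw; apply: holo_cts; apply: df; first exact: sq_bd_sq.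
  by rewrite -subr_eq0; exact: (sq_bd_neq r0 za bw).
pose F : C -> C := fun w => (w - a) * f w.
have dF w : sq a r w -> holo_at F w.
  move=> sw; have [->|wa] := eqVneq w a.
    by exists f => // v; rewrite /F subrr mul0r add0r mulrC.
  apply: holoM; last exact: df.
  by apply: holoB; [exact: holo_id|exact: holo_cst].
have cF : continuous_pts (sq_bd a r) F by move=> w /sq_bd_sq /dF; exact: holo_cts.
(* Cauchy's formula for [f] off [a]. *)
have key z : absC (z - a) < r -> z != a -> f z * winding a r z = cauchy_int a r f z.
  move=> zr zna; have zna0 : z - a != 0 by rewrite subr_eq0.
  have := cauchy_int_diff r0 zr cF.
  rewrite (cauchy_formula r0 dF zr) (cauchy_formula r0 dF za) /F subrr !mul0r add0r.
  have -> : cauchy_int a r (fun w =>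
    (w - a) * f w * cauchy_kernel a w) z = cauchy_int a r f z.
    apply: (eq_sq_int r0) => w bw; congr (_ * _).
    by rewrite mulrAC mulfV ?mul1r //; exact: (sq_bd_neq r0 za bw).
  by move=> h; apply: (mulfI zna0); rewrite mulrA h mulrC.
have dw := winding_holo a r0; have dN := cauchy_int_holo r0 cf.
have wa0 := winding_neq0 a r0.
have [d d0 Hd] := cts_neq0 (holo_cts dw) wa0.
have ka : f a * winding a r a = cauchy_int a r f a.
  apply: (cts_punctured_eq r0 (ctsM ca (holo_cts dw)) (holo_cts dN)).
  by move=> z; exact: key.
have d' : 0 < Num.min d r by rewrite lt_min d0.
apply: (holo_eq d' _ (holoM dN (holoV dw wa0))) => z; rewrite lt_min => /andP[zd zr].
have [->|zna] := eqVneq z a; first by rewrite -ka mulfK.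
by rewrite -key // mulfK // Hd.
Qed.

(** If [f] omitted [c] on the square, then [1 / (f - c)] would be holomorphic
    there and larger at the centre than [center_bound] allows. On the boundary
    [f - c] has modulus at least [d - d / 9], and [9 = 8 + 1] for the constant
    8 of [center_bound]. *)
Lemma image_covers f a r (d : R) : 0 < r -> (forall w, sq a r w -> holo_at f w) -> 
  (forall w, sq_bd a r w -> d <= absC (f w - f a)) ->
  forall c, absC (c - f a) < d / 9 -> exists2 w, sq a r w & f w = c.
Proof.
move=> r0 df fd c cd; apply: contrapT => nc.
have d0 : 0 < d by have := absC_ge0 (c - f a); lra.
have fc w : sq a r w -> f w - c != 0.
  by move=> sw; apply: contra_notN nc; rewrite subr_eq0 => /eqP <-; exists w.
have dg w : sq a r w -> holo_at (fun w => (f w - c)^-1) w.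
  by move=> sw; apply: (holoV (holoB (df w sw) (holo_cst c w))); exact: fc.
have sa : sq a r a by apply: absC_sq; rewrite subrr absC0 ltW.
have := center_bound (k := (d * 8 / 9)^-1) r0 dg.
have e0 : 0 < d * 8 / 9 by rewrite divr_gt0 // mulr_gt0.
have fa0 : 0 < absC (f a - c) by rewrite absC_gt0 fc.
have le w : sq_bd a r w -> absC (f w - c)^-1 <= (d * 8 / 9)^-1.
  move=> bw; rewrite absCV lef_pV2 ?posrE //; last by rewrite absC_gt0 fc //;
    exact: sq_bd_sq.
  by have := fd w bw; have := absC_tri c (f w) (f a); lra.
have e1 : 8 * (d * 8 / 9)^-1 = (d / 9)^-1 by field; rewrite gt_eqF.
move=> /(_ le); rewrite e1 absCV lef_pV2 ?posrE ?divr_gt0 // absC_distC => h.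
by move: cd; rewrite ltNge h.
Qed.

End Consequences.

(** * Inverses of injective holomorphic maps *)

Section Inverse.
Variable R : realType.
Local Notation C := R[i]^o.
Implicit Types (f g h u q : C -> C) (r : R) (z w a c l : C).

(** The value of the derivative is needed only to show that it does not
    vanish, in [derivative_neq0]. *)
Definition has_deriv f z l := exists2 q : C -> C, {for z, continuous q} /\ q z = l &
  forall w, f w = f z + q w * (w - z).

Lemma holo_has_deriv f z : holo_at f z -> exists l, has_deriv f z l.
Proof. by move=> [q cq fE]; exists (q z); exists q. Qed.

Lemma has_deriv_holo f z l : has_deriv f z l -> holo_at f z.
Proof. by move=> [q [cq _] fE]; exists q. Qed.

Lemma has_deriv_unique f z l1 l2 : has_deriv f z l1 -> has_deriv f z l2 -> l1 = l2.
Proof.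
move=> [q [cq <-] fq] [p [cp <-] fp].
apply: (cts_punctured_eq (d := 1) ltr01 cq cp) => w _ wz.
have wz0 : w - z != 0 by rewrite subr_eq0.
by apply: (mulIf wz0); apply: (addrI (f z)); rewrite -fq -fp.
Qed.

Lemma has_derivM f g z l m : has_deriv f z l -> has_deriv g z m -> has_deriv (fun w =>
  f w * g w) z (l * g z + f z * m).
Proof.
move=> df dg; have cg := holo_cts (has_deriv_holo dg).
case: df dg => [q [cq <-] fE] [p [cp <-] gE].
exists (fun w => q w * g w + f z * p w).
  by split; [exact: (ctsD (ctsM cq cg) (ctsM (cts_cst (f z) z) cp))|].
by move=> w; rewrite fE gE; ring.
Qed.

Lemma has_deriv_pow a k z : has_deriv (fun w =>
  (w - a) ^+ k.+1) z (k.+1%:R * (z - a) ^+ k).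
Proof.
elim: k => [|k IH].
  exists (fun=> 1); first by split; [exact: (cts_cst 1 z)|rewrite expr0 mulr1].
  by move=> w; rewrite !expr1 mul1r; ring.
have h1 : has_deriv (fun w => w - a) z 1.
  exists (fun=> 1); first by split; [exact: (cts_cst 1 z)|].
  by move=> w; rewrite mul1r; ring.
have -> : (fun w => (w - a) ^+ k.+2) = (fun w => (w - a) * (w - a) ^+ k.+1).
  by apply/funext => w; rewrite exprS.
have -> : k.+2%:R * (z - a) ^+ k.+1 =
    1 * (z - a) ^+ k.+1 + (z - a) * (k.+1%:R * (z - a) ^+ k).
  by rewrite [(z - a) * _]mulrCA -exprS -mulrDl -[k.+2%:R](natrD _ 1%N k.+1).
exact: has_derivM h1 IH.
Qed.

Lemma open_sq (U : set C) a (e : R) : open U -> U a -> 0 < e ->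
  exists2 r : R, 0 < r < e & sq a r `<=` U.
Proof.
move=> oU Ua e0; have /nbhsC[d d0 Hd] : nbhs a U by exact: open_nbhs_nbhs.
have m0 : 0 < Num.min d e by rewrite lt_min d0.
have h : Num.min d e / 3 < Num.min d e by rewrite ltr_pdivrMr // ltr_pMr // ltr1n.
exists (Num.min d e / 3).
  by rewrite divr_gt0 //=; apply: lt_le_trans h _; rewrite ge_min lexx orbT.
move=> w /sq_absC wa; apply: Hd; apply: le_lt_trans wa _.
have : Num.min d e <= d by rewrite ge_min lexx.
lra.
Qed.

(** Off [a] this is the quotient rule; at [a] the singularity is removable. *)
Lemma quotient_holo f q a r : 0 < r -> (forall w, sq a r w -> holo_at f w) ->
  {for a, continuous q} -> (forall w, f w = f a + q w * (w - a)) ->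
  forall w, holo_at f w -> holo_at q w.
Proof.
move=> r0 df cq fE.
have off w : w != a -> holo_at f w -> holo_at q w.
  move=> wa dfw; have wa0 : w - a != 0 by rewrite subr_eq0.
  have d1 := holoB dfw (holo_cst (f a) w).
  have d2 := holoV (holoB (holo_id w) (holo_cst a w)) wa0.
  apply: (holo_eq (d := absC (w - a)) _ _ (holoM d1 d2)); first by rewrite absC_gt0.
  move=> v vw; rewrite (fE v) addrAC subrr add0r mulfK // subr_eq0.
  by apply: contraTneq vw => ->; rewrite -leNgt absC_distC.
move=> w; have [-> _|wa] := eqVneq w a; last exact: off.
by apply: (removable r0) => // v sv va; apply: off => //; exact: df.
Qed.

(** Cauchy's estimate, from [center_bound] for the difference quotient of [f]
    at [a]. *)
Lemma derivative_bound f a r k l : 0 < r -> (forall w, sq a r w -> holo_at f w) ->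
  (forall w, sq a r w -> absC (f w) <= k) -> has_deriv f a l -> absC l <= 16 * k / r.
Proof.
move=> r0 df fk [q [cq <-] fE].
have sa : sq a r a by apply: absC_sq; rewrite subrr absC0 ltW.
have dq w : sq a r w -> holo_at q w.
  by move=> sw; apply: (quotient_holo r0 df cq fE); exact: df.
have -> : 16 * k / r = 8 * (2 * k / r) by ring.
apply: (center_bound r0 dq) => w bw.
have rw := sqbd_absC r0 bw.
rewrite ler_pdivlMr //.
have : absC (q w) * r <= absC (q w) * absC (w - a) by rewrite ler_wpM2l // absC_ge0.
move=> /le_trans; apply; rewrite -absCM.
have -> : q w * (w - a) = f w - f a by rewrite (fE w) addrAC subrr add0r.
apply: le_trans (absCB _ _) _.
by have := fk a sa; have := fk w (sq_bd_sq bw); lra.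
Qed.

Section InjectiveMap.
Variables (U : set C) (f g : C -> C).
Hypotheses (oU : open U) (df : forall z, U z -> holo_at f z) (gf : forall z, U z ->
  g (f z) = z).

Let fI z w : U z -> U w -> f z = f w -> z = w.
Proof. by move=> Uz Uw fzw; rewrite -(gf Uz) -(gf Uw) fzw. Qed.

(** Openness of [f], and continuity of its inverse, in quantitative form: on
    the boundary of a small square centred at [a] the values of [f] stay away
    from [f a]. *)
Lemma injective_covers a (e : R) : U a -> 0 < e -> exists2 d : R, 0 < d &
  forall c, absC (c - f a) < d -> exists w, [/\ U w, absC (w - a) < e & f w = c].
Proof.
move=> Ua e0; have e2 : 0 < e / 2 by rewrite divr_gt0.
have [r /andP[r0 re] sU] := open_sq oU Ua e2.
have x01 : complex.Re a - r <= complex.Re a + r by lra.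
have y01 : complex.Im a - r <= complex.Im a + r by lra.
have fa w : sq_bd a r w -> f w - f a != 0.
  move=> bw; have rw := sqbd_absC r0 bw; rewrite subr_eq0; apply: contraTneq rw => h.
  by rewrite (fI (sU _ (sq_bd_sq bw)) Ua h) subrr absC0 -ltNge.
have cV : continuous_pts (sq_bd a r) (fun w => (f w - f a)^-1).
  move=> w bw; have cf := holo_cts (df (sU _ (sq_bd_sq bw))).
  exact: (ctsV (ctsB cf (cts_cst (f a) w)) (fa w bw)).
have [k k0 Hk] := rect_bd_bounded x01 y01 cV.
exists (k^-1 / 9); first by rewrite divr_gt0 // invr_gt0.
move=> c hc.
have [|w sw fw] := image_covers (d := k^-1) r0 (fun w sw => df (sU w sw)) _ hc.
  move=> w bw; have := Hk w bw; rewrite absCV => h.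
  have p : 0 < absC (f w - f a) by rewrite absC_gt0 fa.
  by rewrite -[absC _]invrK lef_pV2 // posrE // invr_gt0.
exists w; split=> //; first exact: sU.
by apply: le_lt_trans (sq_absC sw) _; lra.
Qed.

Lemma image_open : open (f @` U).
Proof.
rewrite openE => _ [a Ua <-]; apply/nbhsC.
have [d d0 Hd] := injective_covers Ua ltr01.
by exists d => // c /Hd[w [Uw _ <-]]; exists w.
Qed.

Lemma inverse_cts a : U a -> {for f a, continuous g}.
Proof.
move=> Ua; apply/contC => e e0; have [d d0 Hd] := injective_covers Ua e0.
by exists d => // c /Hd[w [Uw wa <-]]; rewrite !gf.
Qed.

Lemma inverse_holo_neq0 a l : U a -> has_deriv f a l -> l != 0 -> holo_at g (f a).
Proof.
move=> Ua [q [cq <-] fE] qa0.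
have cg := inverse_cts Ua.
have ga : g (f a) = a by exact: gf.
have cqg : {for f a, continuous (fun c => q (g c))}.
  by apply: (cts_comp cg); rewrite ga; exact: cq.
have qga0 : q (g (f a)) != 0 by rewrite ga.
have [d1 d10 H1] := cts_neq0 cqg qga0.
have [d2 d20 H2] := injective_covers Ua ltr01.
have d0 : 0 < Num.min d1 d2 by rewrite lt_min d10.
apply: (holo_near d0 (ctsV cqg qga0)) => c; rewrite lt_min => /andP[cd1 cd2].
have [w [Uw _ fw]] := H2 _ cd2; have gc : g c = w by rewrite -fw gf.
have := H1 _ cd1; rewrite gc ga => qw0.
by rewrite -fw (fE w) [f a + _]addrC addrK mulKf // addrC subrK.
Qed.

(** Divide [f - f a] by [w - a] as long as the quotient vanishes at [a]. If
    this never stopped, [f b - f a] would be divisible by all powers of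
    [b - a]. On the boundary of a square centred at [b] and large enough that
    [w - a] is there at least twice [b - a], [center_bound] bounds the [k]-th
    quotient, and it follows that [f b - f a] is at most a constant times
    [2 ^- k] for all [k]; so [f b = f a]. *)
Lemma finite_order a : U a -> exists k u, [/\ forall w, U w -> holo_at u w, u a != 0 &
  forall w, f w - f a = (w - a) ^+ k * u w].
Proof.
move=> Ua; apply: contrapT => nP.
have P k : exists2 u, forall w, U w -> holo_at u w & forall w,
  f w - f a = (w - a) ^+ k * u w.
  elim: k => [|k [u du fu]].
    exists (fun w => f w - f a); last by move=> w; rewrite expr0 mul1r.
    by move=> w Uw; apply: holoB; [exact: df|exact: holo_cst].
  have ua : u a = 0.
    by apply/eqP; apply: contra_notT nP => ua0; exists k, u.
  have [r /andP[r0 _] sU] := open_sq oU Ua ltr01.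
  have [q cq uE] := du a Ua.
  exists q; last by move=> w; rewrite fu (uE w) ua add0r exprSr mulrCA mulrC.
  by move=> w Uw; apply: (quotient_holo r0 _ cq uE); [move=> v /sU;
    exact: du|exact: du].
have [r /andP[r0 _] sU] := open_sq oU Ua ltr01.
(* The square centred at [b] of half side [3 * t] lies in the square centred
   at [a] of half side [r], as its points are at distance at most [7 * t] from
   [a]. On its boundary [absC (w - a)] is at least [2 * t]. *)
pose t := r / 7; have t0 : 0 < t by rewrite divr_gt0.
pose b : C := a + t%:C%C.
have ba : absC (b - a) = t by rewrite /b addrAC subrr add0r absC_real gtr0_norm.
have T0 : 0 < 3 * t by rewrite mulr_gt0.
have sbU : sq b (3 * t) `<=` U.
  move=> w /sq_absC wb; apply: sU; apply: absC_sq; apply: le_trans (absC_tri b _ _) _.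
  by rewrite ba; move: wb; rewrite /t; lra.
have Ub : U b by apply: sbU; apply: absC_sq; rewrite subrr absC0 ltW.
have x01 : complex.Re b - 3 * t <= complex.Re b + 3 * t by lra.
have y01 : complex.Im b - 3 * t <= complex.Im b + 3 * t by lra.
have cfa : continuous_pts (sq_bd b (3 * t)) (fun w => f w - f a).
  move=> w /sq_bd_sq/sbU Uw; exact: (ctsB (holo_cts (df Uw)) (cts_cst (f a) w)).
have [M M0 HM] := rect_bd_bounded x01 y01 cfa.
have le k : absC (f b - f a) <= 8 * M / 2 ^+ k.
  have [u du fu] := P k.
  have tk : 0 < (2 * t) ^+ k by rewrite exprn_gt0 // mulr_gt0.
  have ub : absC (u b) <= 8 * (M / (2 * t) ^+ k).
    apply: (center_bound T0); first by move=> w /sbU; exact: du.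
    move=> w bw; rewrite ler_pdivlMr //; apply: le_trans (HM w bw).
    rewrite fu absCM absCX mulrC ler_wpM2r ?absC_ge0 // lerXn2r ?nnegrE ?absC_ge0 //.
      by rewrite mulr_ge0 // ltW.
    have := sqbd_absC T0 bw; have := absC_tri a w b;
      rewrite [absC (a - b)]absC_distC ba; lra.
  rewrite fu absCM absCX ba.
  apply: le_trans (ler_wpM2l _ ub) _; first by rewrite exprn_ge0 // ltW.
  have A0 : t ^+ k != 0 by rewrite expf_neq0 // gt_eqF.
  have B0 : 2 ^+ k != 0 :> R by rewrite expf_neq0.
  rewrite [(2 * t) ^+ k]exprMn; move: (t ^+ k) (2 ^+ k) A0 B0 => A B A0 B0.
  by rewrite le_eqVlt; apply/orP; left; apply/eqP; field; rewrite A0 B0.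
have ab : f b = f a.
  apply/eqP; rewrite -subr_eq0 -absC_eq0 eq_le absC_ge0 andbT; apply/ler_addgt0Pl =>
    e e0.
  rewrite addr0; have := @cvg_geometric R (8 * M) (2^-1).
  rewrite ger0_norm ?invr_ge0 // invf_lt1 // ltr1n => /(_ isT).
  move=> /cvgrPdist_lt /(_ e e0) [N _ /(_ N (leqnn N))].
  rewrite sub0r normrN /geometric /= exprVn => h.
  by apply: le_trans (le N) _; apply: le_trans (ltW h); exact: ler_norm.
by have := fI Ub Ua ab => bE; move: ba; rewrite bE subrr absC0 => /eqP; rewrite lt_eqF.
Qed.

(** The derivative of [(w - a) ^+ k.+1 * u w] is [(z - a) ^+ k] times
    [k.+1%:R * u z + (z - a) * m] with [m] the derivative of [u] at [z]. By
    [derivative_bound] the numbers [m] are bounded, so the second factor is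
    near [k.+1%:R * u a], which is not 0. *)
Lemma derivative_neq0 a : U a -> exists2 d : R, 0 < d & forall z l,
  absC (z - a) < d -> z != a ->
  has_deriv f z l -> l != 0.
Proof.
move=> Ua; have [k [u [du ua0 fu]]] := finite_order Ua.
case: k fu => [fu|k fu].
  by move: ua0; have := fu a; rewrite subrr expr0 mul1r => <-; rewrite eqxx.
have [r /andP[r0 _] sU] := open_sq oU Ua ltr01.
have cu := holo_cts (du a Ua).
have u2 : 0 < absC (u a) / 2 by rewrite divr_gt0 // absC_gt0.
have [d1 d10 H1] := (contC u a).1 cu _ u2.
(* A bound for [u] near [a], where [u] differs from [u a] by at most half of
   its modulus. *)
pose M := 2 * absC (u a).
have M0 : 0 < M by rewrite mulr_gt0 // absC_gt0.
have m0 : 0 < Num.min d1 r by rewrite lt_min d10.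
pose s := Num.min d1 r / 4; have s0 : 0 < s by rewrite divr_gt0.
have sd1 : s <= d1 / 4 by rewrite ler_pM2r // ge_min lexx.
have sr : s <= r / 4 by rewrite ler_pM2r // ge_min lexx orbT.
pose d := Num.min s (absC (u a) / 2 / (16 * M / s)).
have B0 : 0 < 16 * M / s by rewrite divr_gt0 // mulr_gt0.
have d0 : 0 < d by rewrite lt_min s0 divr_gt0.
exists d => // z l; rewrite lt_min => /andP[zs zB] za dz.
have near w : sq z s w -> absC (w - a) < d1 /\ U w.
  move=> /sq_absC wz; have wa : absC (w - a) <= 3 * s by have := absC_tri z w a; lra.
  split; first by lra.
  by apply: sU; apply: absC_sq; lra.
have Uz : U z by apply: (near z _).2; apply: absC_sq; rewrite subrr absC0 ltW.
have [m dm] := holo_has_deriv (du z Uz).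
have mB : absC m <= 16 * M / s.
  apply: (derivative_bound s0 _ _ dm) => w /near[wd Uw]; first exact: du.
  by have := H1 w wd; have := absC_dist (u w) (u a); rewrite /M; lra.
have [m' dm'] : exists2 m', m' = l & has_deriv (fun w => f w - f a) z m'.
  case: dz => q [cq ql] fE; exists l => //; exists q => // w.
  by rewrite (fE w); ring.
have -> : (fun w => f w - f a) = (fun w => (w - a) ^+ k.+1 * u w) by apply/funext.
move=> h; have h2 := has_derivM (has_deriv_pow a k z) dm.
rewrite -dm' (has_deriv_unique h h2).
have -> : k.+1%:R * (z - a) ^+ k * u z + (z - a) ^+ k.+1 * m =
   (z - a) ^+ k * (k.+1%:R * u z + (z - a) * m) by rewrite exprS; ring.
rewrite mulf_neq0 // ?expf_neq0 ?subr_eq0 //.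
rewrite addr_eq0; apply/negP => /eqP E.
have : absC (u z) <= absC ((z - a) * m).
  rewrite -[X in _ <= X]absCN -E absCM ler_peMl ?absC_ge0 //.
  have -> : (k.+1%:R : C) = (k.+1%:R : R)%:C%C by rewrite rmorph_nat.
  by rewrite absC_real ger0_norm // ler1n.
rewrite absCM => h3.
have : absC (z - a) * absC m <= absC (z - a) * (16 * M / s)
  by rewrite ler_wpM2l ?absC_ge0.
move: zB; rewrite ltr_pdivlMr // => zB h4.
have zd1 : absC (z - a) < d1 by lra.
by have := H1 z zd1; have := absC_dist (u a) (u z); rewrite absC_distC; lra.
Qed.

(** At the images of the points near [a] other than [a] the derivative of [f]
    does not vanish and the inverse is holomorphic; at [f a] it is continuous,
    so that the singularity is removable. *)
Theorem inverse_holo a : U a -> holo_at g (f a).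
Proof.
move=> Ua; have [d d0 Hd] := derivative_neq0 Ua.
have [e e0 He] := injective_covers Ua d0.
have e3 : 0 < e / 3 by rewrite divr_gt0.
apply: (removable e3); last exact: inverse_cts.
move=> c /sq_absC ce cfa.
have [w [Uw wa fw]] : exists w, [/\ U w, absC (w - a) < d & f w = c] by apply: He; lra.
have [l dl] := holo_has_deriv (df Uw); rewrite -fw.
apply: (inverse_holo_neq0 Uw dl (Hd _ _ wa _ dl)).
by apply: contraNneq cfa => wE; rewrite -fw wE.
Qed.

End InjectiveMap.

End Inverse.

(** * Compactness and connectedness in metric form *)

Section Compactness.
Variable R : realType.
Local Notation C := R[i]^o.
Implicit Types (X : set C) (z w : C).

(** The form in which compactness is used: thresholds that are locally uniform
    are uniform. *)
Lemma compact_uniform X (P : nat -> C -> Prop) : compact X ->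
  (forall x, X x -> exists N (e : R), 0 < e /\ 
     forall y n, X y -> absC (y - x) < e -> (N <= n)%N -> P n y) ->
  exists N, forall n, (N <= n)%N -> forall x, X x -> P n x.
Proof.
move=> /compact_near_coveringP cX H.
have [N _ HN] : \forall n \near \oo, X `<=` [set x | X x -> P n x].
  apply: (cX nat \oo (fun n x => X x -> P n x)) => x Xx.
  have [N [e [e0 He]]] := H x Xx.
  exists ([set y | absC (y - x) < e], [set n | (N <= n)%N]); last first.
    by move=> [y n] [/= h1 h2 Xy]; exact: He.
  by split; [apply/nbhsC; exists e|exists N].
by exists N => n Nn x Xx; exact: (HN n Nn x Xx Xx).
Qed.

Lemma invn_lt (e : R) : 0 < e -> exists N, forall n, (N <= n)%N -> n.+1%:R^-1 < e.
Proof.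
move=> e0; have := @cvg_harmonic R => /cvgrPdist_lt /(_ e e0) [N _ HN].
by exists N => n /HN; rewrite /= sub0r normrN ger0_norm // invr_ge0.
Qed.

Lemma compact_dist (E F : set C) : compact E -> closed F -> E `&` F = set0 ->
  exists2 e : R, 0 < e & forall x y, E x -> F y -> e <= absC (x - y).
Proof.
move=> cE cF EF.
have [N HN] : exists N, forall n, (N <= n)%N -> forall x, E x -> 
    (forall y, F y -> n.+1%:R^-1 <= absC (x - y)).
  apply: (compact_uniform (P := fun n x => forall y, F y ->
    n.+1%:R^-1 <= absC (x - y))) => // x Ex.
  have nFx : ~ F x by move=> Fx; suff : set0 x by []; rewrite -EF.
  have /nbhsC[e e0 He] : nbhs x (~` F) by apply: open_nbhs_nbhs; split => //;
    exact: closed_openC.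
  have e2 : 0 < e / 2 by rewrite divr_gt0.
  have [M HM] := invn_lt e2.
  exists M, (e / 2); split => // y n Ey yx /HM nM z Fz.
  have : e <= absC (z - x) by rewrite leNgt; apply/negP => /He /(_ Fz).
  have := absC_tri y z x; rewrite [absC (z - y)]absC_distC.
  by move: (_^-1) nM => s nM; lra.
by exists N.+1%:R^-1 => // x y Ex Fy; exact: HN.
Qed.

Definition dist_set (E : set C) z : R := inf [set absC (z - e) | e in E].

Lemma dist_set_le (E : set C) z e : E e -> dist_set E z <= absC (z - e).
Proof.
move=> Ee; apply: ge_inf; last by exists e.
by exists 0 => _ [x _ <-]; exact: absC_ge0.
Qed.

Lemma dist_set_ge (E : set C) z (d : R) : E !=set0 -> (forall e, E e ->
  d <= absC (z - e)) ->
  d <= dist_set E z.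
Proof.
move=> [e0 Ee0] H; apply: lb_le_inf; first by exists (absC (z - e0)); exists e0.
by move=> _ [x Ex <-]; exact: H.
Qed.

Lemma dist_set_lip (E : set C) z w : E !=set0 -> `|dist_set E z - dist_set E w|
  <= absC (z - w).
Proof.
move=> E0.
have le u v : dist_set E u - dist_set E v <= absC (u - v).
  rewrite lerBlDr addrC -lerBlDr; apply: dist_set_ge => // e Ee.
  have := dist_set_le u Ee; have := absC_tri v u e; lra.
by rewrite ler_norml le andbT lerNl opprB absC_distC le.
Qed.

Lemma dist_set_ge0 (E : set C) z : E !=set0 -> 0 <= dist_set E z.
Proof. by move=> E0; apply: dist_set_ge => // e _; exact: absC_ge0. Qed.

Lemma dist_set0 (E : set C) z : E z -> dist_set E z = 0.
Proof.
move=> Ez; apply/eqP; rewrite eq_le dist_set_ge0; last by exists z.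
by have := dist_set_le z Ez; rewrite subrr absC0 => ->.
Qed.

Lemma connected_meet (T : topologicalType) (S P Q : set T) : connected S ->
  closed P -> closed Q ->
  S `<=` P `|` Q -> S `&` P !=set0 -> S `&` Q !=set0 -> S `&` (P `&` Q) !=set0.
Proof.
move=> cS cP cQ SPQ [x [Sx Px]] [y [Sy Qy]]; apply: contrapT => n0.
have sep : separated (S `&` P) (S `&` Q).
  split; rewrite -subset0.
    move=> z [/closureI[_ /cP Pz] [Sz Qz]]; apply: n0; by exists z.
  move=> z [[Sz Pz] /closureI[_ /cQ Qz]]; apply: n0; by exists z.
have [|h|h] := connected_subset sep _ cS.
- by move=> z Sz; case: (SPQ z Sz); [left|right].
- by apply: n0; exists y; split=> //; split=> //; case: (h y Sy).
- by apply: n0; exists x; split=> //; split=> //; case: (h x Sx).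
Qed.

Lemma locally_constant (P : set C) (T : Type) (h : C -> T) (eta : R) : connected P ->
  0 < eta ->
  (forall z w, P z -> P w -> absC (w - z) < eta -> h w = h z) ->
  forall z w, P z -> P w -> h w = h z.
Proof.
move=> cP e0 H z w Pz Pw.
suff : [set x | P x /\ h x = h z] = P by move=> E; have [] : [set x | P x /\
  h x = h z] w by rewrite E.
have obig (S : set C) : open [set x | exists2 y, S y & absC (x - y) < eta].
  rewrite openE => x [y Sy xy]; apply/nbhsC; exists (eta - absC (x - y));
    first by rewrite subr_gt0.
  by move=> v vx; exists y => //; have := absC_tri x v y; lra.
apply: cP.
- by exists z.
- exists [set x | exists2 y, (P y /\ h y = h z) & absC (x - y) < eta];
  first exact: obig.
  apply/seteqP; split => [x [Px hx]|x [Px [y [Py hy] xy]]].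
    by split=> //; exists x => //; rewrite subrr absC0.
  by split=> //; rewrite -hy; exact: H.
- exists (~` [set x | exists2 y, (P y /\ h y <> h z) & absC (x - y) < eta]).
    exact/open_closedC/obig.
  apply/seteqP; split => [x [Px hx]|x [Px nx]].
    by split=> // -[y [Py hy] xy]; apply: hy; rewrite -hx; apply: H => //;
      rewrite absC_distC.
  split=> //; apply: contrapT => hx; apply: nx; exists x => //; by rewrite subrr absC0.
Qed.

End Compactness.

(** * Representatives modulo 1 *)

Section Rounding.
Variable R : realType.
Implicit Types x y : R.

(** Used to lift small increments of a function with values in the circle
    [R / Z] to [R]. *)
Definition frac_rep x : R := x - (Num.floor (x + 1 / 2))%:~R.

Lemma frac_rep_unique x y (m : int) : x = y + m%:~R -> `|y| < 1 / 2 -> frac_rep x = y.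
Proof.
move=> -> /[!ltr_norml]/andP[y1 y2]; rewrite /frac_rep.
have -> : Num.floor (y + m%:~R + 1 / 2) = m.
  by apply: floor_def; rewrite rmorphD /=; apply/andP; split; lra.
by rewrite addrK.
Qed.

Lemma frac_rep_small x : `|x| < 1 / 2 -> frac_rep x = x.
Proof. by apply: (@frac_rep_unique _ _ 0); rewrite addr0. Qed.

Lemma frac_repE x : exists m : int, x = frac_rep x + m%:~R.
Proof. by exists (Num.floor (x + 1 / 2)); rewrite subrK. Qed.

(** Small increments add up without carry. *)
Lemma frac_rep_add x y : `|frac_rep x| < 1 / 4 -> `|frac_rep y| < 1 / 4 ->
  frac_rep (x + y) = frac_rep x + frac_rep y.
Proof.
have [m xm] := frac_repE x; have [n yn] := frac_repE y => hx hy.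
apply: (@frac_rep_unique _ _ (m + n)); first by rewrite {1}xm {1}yn rmorphD /=; ring.
by apply: le_lt_trans (ler_normD _ _) _; lra.
Qed.

End Rounding.

(** * Unicoherence of convex sets *)

Section Unicoherence.
Variable R : realType.
Local Notation C := R[i]^o.
Implicit Types (z w : C) (t : R).

Lemma segment_point (K P Q : set C) z w : closed P -> closed Q -> K `<=` P `|` Q ->
  (forall t, 0 <= t <= 1 -> K (z + t%:C%C * (w - z))) -> P z -> Q w ->
  exists e, [/\ P e, Q e, absC (z - e) <= absC (z - w) & absC (e - w) <= absC (z - w)].
Proof.
move=> cP cQ KPQ sK Pz Qw.
pose h t : C := z + t%:C%C * (w - z).
have ch : continuous h.
  move=> t; have c1 := @continuous_toC R t.
  exact: (ctsD (cts_cst z t) (ctsM c1 (cts_cst (w - z) t))).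
have cS : connected (h @` `[0, 1]).
  by apply: connected_continuous_connected;
    [exact: segment_connected|exact: continuous_subspaceT].
have h0 : h 0 = z by rewrite /h mul0r addr0.
have h1 : h 1 = w by rewrite /h mul1r addrC subrK.
have [||| e [[t]]] := connected_meet cS cP cQ.
- by move=> _ [t /= + <-]; rewrite in_itv /= => /sK /KPQ.
- by exists z; split=> //; exists 0 => //=; rewrite in_itv /= lexx ler01.
- by exists w; split=> //; exists 1 => //=; rewrite in_itv /= lexx ler01.
rewrite /= in_itv /= => /andP[t0 t1] te [Pe Qe]; exists e; split=> //.
  rewrite -te /h opprD addrA subrr add0r absCN absCM absC_real ger0_norm // absC_distC.
  by rewrite ler_piMl // absC_ge0.
have -> : e - w = (1 - t)%:C%C * (z - w) by rewrite -te /h rmorphB /=; ring.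
by rewrite absCM absC_real ger0_norm ?subr_ge0 // ler_piMl ?absC_ge0 //; lra.
Qed.

Section Convex.
Variables (K P Q : set C) (B : R).
Hypotheses (convK : forall z w t, K z -> K w -> 0 <= t <= 1 -> K (z + t%:C%C * (w - z)))
  (K0 : K 0) (KB : forall z, K z -> absC z <= B)
  (cP : closed P) (cQ : closed Q) (cPQ : compact (P `&` Q)) (PQK : P `|` Q = K).

(** Suppose that the intersection of [P] and [Q] is separated into [S false]
    and [S true]. Let [lam] be continuous, 0 on [S false] and 1/2 on [S true],
    and let [v] be [lam] on [P] and [- lam] on [Q]. Both definitions agree
    modulo 1 on the intersection, so [v] is a continuous map from [K] to the
    circle. Since [K] is star-shaped [v] lifts to a function [L] with values
    in [R], whose small increments are those of [v]. Thus [L - lam] is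
    constant on [P] and [L + lam] is constant on [Q], and the increment of [L]
    from [S false] to [S true] would be both 1/2 and -1/2. *)
Theorem unicoherent : connected P -> connected Q -> connected (P `&` Q).
Proof.
move=> conP conQ; apply: contrapT => /connectedPn[S [S0 PQS [S1 S2]]].
have clPQ : closed (P `&` Q) by exact: closedI.
have sub b : S b `<=` P `&` Q by rewrite PQS; case: b;
  [exact: subsetUr|exact: subsetUl].
have closub b : closure (S b) `<=` P `&` Q.
  by move=> x /(closureS (@sub b)); exact: clPQ.
have cl b : closed (S b).
  move=> x clx; have : (P `&` Q) x by exact: closub clx.
  rewrite PQS; case: b clx => clx [] // Sx.
    by suff : set0 x by []; rewrite -S2.
  by suff : set0 x by []; rewrite -S1.
have dis : S false `&` S true = set0.
  by rewrite -subset0 => x [x1 x2]; rewrite -S1; split=> //; exact: subset_closure.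
have cpt : compact (S false) by apply: (subclosed_compact (cl false) cPQ); exact: sub.
have [ep ep0 Hep] := compact_dist cpt (cl true) dis.
have Sne := S0 false.
pose lam z : R := Num.min (1 / 2) (dist_set (S false) z / (2 * ep)).
have lamE z : S false z -> lam z = 0.
  by move=> /dist_set0; rewrite /lam => ->; rewrite mul0r min_r.
have lamF z : S true z -> lam z = 1 / 2.
  move=> Sz; rewrite /lam min_l // ler_pdivlMr ?mulr_gt0 //.
  have -> : 1 / 2 * (2 * ep) = ep by field.
  by apply: dist_set_ge => // e Se; rewrite absC_distC; exact: Hep.
have lam_lip z w : `|lam z - lam w| <= absC (z - w) / (2 * ep).
  have : `|dist_set (S false) z / (2 * ep) - dist_set (S false) w / (2 * ep)|
    <= absC (z - w) / (2 * ep).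
    have e2 : 0 < (2 * ep)^-1 by rewrite invr_gt0 mulr_gt0.
    by rewrite -mulrBl normrM [X in _ * X]gtr0_norm // ler_pM2r // dist_set_lip.
  rewrite /lam; move: (_ / (2 * ep)) (dist_set _ w / _) (absC _ / _) => x y b.
  rewrite !minEle; case: ifP => h1; case: ifP => h2; rewrite !ler_norml => /andP[? ?];
    apply/andP; split; lra.
pose eta := ep / 8.
have eta0 : 0 < eta by rewrite divr_gt0.
have lam_near z w : absC (z - w) < eta -> `|lam z - lam w| < 1 / 8.
  move=> zw; apply: le_lt_trans (lam_lip z w) _.
  by rewrite ltr_pdivrMr ?mulr_gt0 //; move: zw; rewrite /eta; lra.
pose v z : R := if pselect (P z) then lam z else - lam z.
have vP z : P z -> v z = lam z by rewrite /v; case: pselect.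
have vQ z : Q z -> exists m : int, v z = - lam z + m%:~R.
  rewrite /v; case: pselect => Pz Qz; last by exists 0; rewrite addr0.
  have : (P `&` Q) z by [].
  rewrite PQS => -[/lamE ->|/lamF ->]; first by exists 0; rewrite oppr0 addr0.
  by exists 1; rewrite /= mulr1z; lra.
(* The increment of [v] in the circle, lifted to [R]. *)
pose d z w : R := frac_rep (v w - v z).
have dP z w : P z -> P w -> absC (z - w) < eta -> d z w = lam w - lam z.
  move=> Pz Pw; rewrite absC_distC => /lam_near h;
    rewrite /d !vP // frac_rep_small //; lra.
have dQ z w : Q z -> Q w -> absC (z - w) < eta -> d z w = lam z - lam w.
  move=> Qz Qw /lam_near h; have [m mE] := vQ z Qz; have [n nE] := vQ w Qw.
  by apply: (@frac_rep_unique _ _ _ (n - m)); [rewrite mE nE rmorphB /=; ring|lra].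
have KPQ : K `<=` P `|` Q by rewrite PQK.
(* The segment from a point of [P] to one of [Q] meets both sets at a common
   point [e]; the increment is the sum of those to and from [e]. *)
have cross z w : K z -> K w -> P z -> Q w -> absC (z - w) < eta -> `|d z w| < 1 / 4 /\
  `|d w z| < 1 / 4.
  move=> Kz Kw Pz Qw zw.
  have [e [Pe Qe ze ew]] := segment_point cP cQ KPQ (fun t => convK Kz Kw) Pz Qw.
  have ze' := le_lt_trans ze zw; have ew' := le_lt_trans ew zw.
  have n1 : `|d z e| < 1 / 8 by rewrite dP // distrC; exact: lam_near.
  have n2 : `|d e w| < 1 / 8 by rewrite dQ //; exact: lam_near.
  have n3 : `|d e z| < 1 / 8 by rewrite dP // 1?absC_distC //; exact: lam_near.
  have n4 : `|d w e| < 1 / 8.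
    by rewrite dQ // 1?absC_distC // distrC; exact: lam_near.
  have q : 1 / 8 < 1 / 4 :> R by lra.
  have sum8 (x y : R) : `|x| < 1 / 8 -> `|y| < 1 / 8 -> `|x + y| < 1 / 4.
    by move=> hx hy; apply: le_lt_trans (ler_normD _ _) _; lra.
  have -> : d z w = d z e + d e w.
    rewrite {1}/d (_ : v w - v z = (v e - v z) + (v w - v e)); last by ring.
    by rewrite frac_rep_add //; apply: lt_trans q.
  have -> : d w z = d w e + d e z.
    rewrite {1}/d (_ : v z - v w = (v e - v w) + (v z - v e)); last by ring.
    by rewrite frac_rep_add //; apply: lt_trans q.
  by split; apply: sum8.
have dsmall z w : K z -> K w -> absC (z - w) < eta -> `|d z w| < 1 / 4.
  move=> Kz Kw zw; have h := lam_near _ _ zw.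
  have [Pz|Qz] := KPQ z Kz; have [Pw|Qw] := KPQ w Kw.
  - by rewrite dP // distrC; lra.
  - by case: (cross z w Kz Kw Pz Qw zw).
  - by rewrite absC_distC in zw; case: (cross w z Kw Kz Pw Qz zw).
  - by rewrite dQ //; lra.
have dadd z w x : K z -> K w -> K x -> absC (z - w) < eta -> absC (w - x) < eta ->
    d z x = d z w + d w x.
  move=> Kz Kw Kx zw wx; rewrite {1}/d (_ : v x - v z = (v w - v z) + (v x - v w));
    last by ring.
  by rewrite frac_rep_add //; exact: dsmall.
have B0 : 0 <= B by apply: le_trans (KB K0); exact: absC_ge0.
have [N HN] : exists N : nat, B / N.+1%:R < eta / 2.
  have e2 : 0 < eta / 2 / (B + 1) by rewrite !divr_gt0 // ltr_wpDl.
  have [N HN] := invn_lt e2; exists N.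
  have := HN N (leqnn N); rewrite ltr_pdivlMr ?ltr_wpDl // => h.
  by apply: le_lt_trans h; rewrite mulrC ler_wpM2l ?invr_ge0 // lerDl.
(* The points that divide the segment from 0 to [z] into [n] equal parts. *)
pose n := N.+1; pose p k z : C := (k%:R / n%:R)%:C%C * z.
have pK k z : (k <= n)%N -> K z -> K (p k z).
  move=> kn Kz; have := convK (t := k%:R / n%:R) K0 Kz; rewrite add0r subr0; apply.
  by rewrite divr_ge0 //= ler_pdivrMr ?ltr0n // mul1r ler_nat.
have pdist k z w : (k <= n)%N -> absC (p k z - p k w) <= absC (z - w).
  move=> kn; rewrite -mulrBr absCM absC_real ger0_norm ?divr_ge0 //.
  by rewrite ler_piMl ?absC_ge0 // ler_pdivrMr ?ltr0n // mul1r ler_nat.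
have pstep k z : K z -> absC (p k z - p k.+1 z) < eta / 2.
  move=> Kz; have -> : p k z - p k.+1 z = - ((1 / n%:R)%:C%C * z).
    rewrite /p -mulrBl -rmorphB /= -mulrBl -mulNr -rmorphN /=; congr (_%:C%C * _).
    by rewrite -natr1; ring.
  rewrite absCN absCM absC_real ger0_norm ?divr_ge0 //; apply: le_lt_trans HN.
  by rewrite mulrAC mul1r ler_wpM2r ?invr_ge0 // KB.
(* The increments of [v] along the segment from 0 to [z]. *)
pose L z := \sum_(k < n) d (p k z) (p k.+1 z).
have Ldiff z w : K z -> K w -> absC (w - z) < eta / 2 -> L w - L z = d z w.
  move=> Kz Kw wz.
  (* Opposite increments across the quadrilaterals between the two segments
     cancel. *)
  have key m : (m <= n)%N -> \sum_(k < m) d (p k w) (p k.+1 w) - \sum_(k < m) d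
    (p k z) (p k.+1 z)
      = d (p m z) (p m w).
    elim: m => [_|m IH mn].
      by rewrite !big_ord0 subrr /p mul0r !mul0r /d subrr frac_rep_small // normr0; lra.
    rewrite !big_ord_recr /= opprD addrACA IH; last exact: ltnW.
    have mn' : (m <= n)%N by exact: ltnW.
    have e1 : absC (p m z - p m w) < eta by have := pdist m z w mn';
      rewrite absC_distC in wz; lra.
    have e2 : absC (p m w - p m.+1 w) < eta by have := pstep m w Kw; lra.
    have e3 : absC (p m z - p m.+1 z) < eta by have := pstep m z Kz; lra.
    have e4 : absC (p m.+1 z - p m.+1 w) < eta by have := pdist m.+1 z w mn;
      rewrite absC_distC in wz; lra.
    have := dadd _ _ _ (pK _ _ mn' Kz) (pK _ _ mn' Kw) (pK _ _ mn Kw) e1 e2.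
    have := dadd _ _ _ (pK _ _ mn' Kz) (pK _ _ mn Kz) (pK _ _ mn Kw) e3 e4.
    by move=> E2 E1; rewrite addrA -E1 E2 addrAC subrr add0r.
  have pn x : p n x = x by rewrite /p divff ?pnatr_eq0 // mul1r.
  by rewrite /L key // !pn.
have e20 : 0 < eta / 2 by rewrite divr_gt0.
have KP : P `<=` K by rewrite -PQK; exact: subsetUl.
have KQ : Q `<=` K by rewrite -PQK; exact: subsetUr.
have constP := @locally_constant R P R (fun z => L z - lam z) (eta / 2) conP e20 _.
have constQ := @locally_constant R Q R (fun z => L z + lam z) (eta / 2) conQ e20 _.
have [a Sa] := S0 false; have [b Sb] := S0 true.
have [Pa Qa] := sub _ _ Sa; have [Pb Qb] := sub _ _ Sb.
have : L b - lam b = L a - lam a.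
  apply: constP => // z w Pz Pw zw; have := Ldiff z w (KP _ Pz) (KP _ Pw) zw.
  by rewrite dP //; [lra|rewrite absC_distC; lra].
have : L b + lam b = L a + lam a.
  apply: constQ => // z w Qz Qw zw; have := Ldiff z w (KQ _ Qz) (KQ _ Qw) zw.
  by rewrite dQ //; [lra|rewrite absC_distC; lra].
by rewrite (lamE a) // (lamF b) //; lra.
Qed.

End Convex.

End Unicoherence.

(** * Connected subsets of the plane *)

Section PlaneTopology.
Variable R : realType.
Local Notation C := R[i]^o.
Implicit Types (z w c : C) (A B D O S X : set C) (f : C -> C) (t M : R).

Lemma within_pts X f : continuous_pts X f -> {within X, continuous f}.
Proof. by move=> cf; apply: continuous_in_subspaceT => x; rewrite inE; exact: cf. Qed.

Lemma continuous_pts_sub (T U : topologicalType) (S1 S2 : set T) (f : T ->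
  U) : S1 `<=` S2 ->
  continuous_pts S2 f -> continuous_pts S1 f.
Proof. by move=> S12 cf z /S12; exact: cf. Qed.

Lemma image_connected S f : continuous_pts S f -> connected S -> connected (f @` S).
Proof. by move=> cf cS; apply: connected_continuous_connected => //;
  exact: within_pts. Qed.

Lemma image_compact S f : continuous_pts S f -> compact S -> compact (f @` S).
Proof. by move=> cf cS; apply: continuous_compact => //; exact: within_pts. Qed.

Lemma compact_closedC S : compact S -> closed S.
Proof. by apply: compact_closed; exact: norm_hausdorff. Qed.

Lemma star_connected S c : S c -> (forall z t, S z -> 0 <= t <= 1 ->
  S (c + t%:C%C * (z - c))) ->
  connected S.
Proof.
move=> Sc H.
pose h z t : C := c + t%:C%C * (z - c).
have ch z : continuous (h z).
  move=> t; have c1 := @continuous_toC R t.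
  exact: (ctsD (cts_cst c t) (ctsM c1 (cts_cst (z - c) t))).
have -> : S = \bigcup_(z in S) (h z @` `[0, 1]).
  apply/seteqP; split => [z Sz|_ [z Sz [t /= + <-]]].
    by exists z => //; exists 1; rewrite /= ?in_itv /= ?lexx ?ler01 // /h mul1r addrC
      subrK.
  by rewrite in_itv /=; exact: H.
apply: bigcup_connected.
  by exists c => z _; exists 0; rewrite /= ?in_itv /= ?lexx ?ler01 // /h mul0r addr0.
move=> z _; apply: connected_continuous_connected; first exact: segment_connected.
exact: continuous_subspaceT.
Qed.

Lemma plane_connected : connected [set: C].
Proof. exact: (@star_connected _ 0). Qed.

(** The complement of a closed square: a union of four half planes, each of
    which meets the next, hence connected. *)
Definition outside M : set C := [set z | M < `|complex.Re z| \/ M < `|complex.Im z|].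

Lemma outside_connected M : 0 <= M -> connected (outside M).
Proof.
move=> M0.
pose H1 : set C := [set z | M < complex.Re z]; pose H2 : set C := [set z |
  complex.Re z < - M].
pose H3 : set C := [set z | M < complex.Im z]; pose H4 : set C := [set z |
  complex.Im z < - M].
have -> : outside M = (H1 `|` H3) `|` (H2 `|` H4).
  apply/seteqP; split=> z; rewrite /outside /H1 /H2 /H3 /H4 /=.
    by rewrite !ltr_normr => -[/orP[?|?]|/orP[?|?]];
     [left; left|right; left; lra|left; right|right; right; lra].
  rewrite !ltr_normr => -[[->|->]|[h|h]]; first by left.
  - by right.
  - by left; apply/orP; right; lra.
  - by right; apply/orP; right; lra.
have conv (l : C -> R) (c : C) : (forall t z w,
  l (z + t%:C%C * (w - z)) = l z + t * (l w - l z)) ->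
    M < l c -> connected [set z | M < l z].
  move=> lE Mc; apply: (@star_connected _ c) => // z t /= Mz /andP[t0 t1]; rewrite lE.
  have h1 : 0 <= t * (l z - M) by rewrite mulr_ge0 // subr_ge0 ltW.
  have h2 : 0 <= (1 - t) * (l c - M) by rewrite mulr_ge0 // subr_ge0 // ltW.
  have [->|t0'] := eqVneq t 0; first by rewrite mul0r addr0.
  have : 0 < t * (l z - M) by rewrite mulr_gt0 ?subr_gt0 // lt_def t0' t0.
  lra.
have ReL t z w : complex.Re (z + t%:C%C * (w - z)) = complex.Re z + t *
  (complex.Re w - complex.Re z).
  by case: z w => a b [a' b'] /=; rewrite mul0r subr0.
have ImL t z w : complex.Im (z + t%:C%C * (w - z)) = complex.Im z + t *
  (complex.Im w - complex.Im z).
  by case: z w => a b [a' b'] /=; rewrite mul0r addr0.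
have c1 : connected H1 by apply: (conv (@complex.Re R) (M + 1)%:C%C ReL) => /=; lra.
have c3 : connected H3 by apply: (conv (@complex.Im R) (0 +i* (M + 1))%C ImL) => /=;
  lra.
have c2 : connected H2.
  have -> : H2 = [set z | M < - complex.Re z] by apply/seteqP; split=> z;
    rewrite /H2 /=; lra.
  apply: (conv (fun z => - complex.Re z) (- (M + 1))%:C%C) => [t z w|/=]; last by lra.
  by rewrite ReL; ring.
have c4 : connected H4.
  have -> : H4 = [set z | M < - complex.Im z] by apply/seteqP; split=> z;
    rewrite /H4 /=; lra.
  apply: (conv (fun z => - complex.Im z) (0 +i* (- (M + 1)))%C) => [t z w|/=];
    last by lra.
  by rewrite ImL; ring.
apply: connectedU.
- by exists ((M + 1) +i* (- (M + 1)))%C; split; [left|right]; rewrite /H1 /H4 /=; lra.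
- apply: connectedU => //; exists ((M + 1) +i* (M + 1))%C; rewrite /H1 /H3 /=;
  split => /=; lra.
- apply: connectedU => //; exists ((- (M + 1)) +i* (- (M + 1)))%C; rewrite /H2 /H4;
  split => /=; lra.
Qed.

Definition bounded_absC S := exists M : R, forall z, S z -> absC z <= M.

Lemma bounded_absCP S : bounded_set S <-> bounded_absC S.
Proof.
split=> [[M [Mreal HM]]|[M HM]].
  exists (complex.Re M + 1) => z Sz.
  have lt : M < (complex.Re M + 1)%:C%C.
    by rewrite -{1}(RRe_real Mreal) ltcR ltrDl.
  by rewrite -lecR -absCE; exact: (HM _ lt z Sz).
exists M%:C%C; split; first by apply/complex_realP; exists M.
move=> N MN z Sz /=; apply: le_trans (ltW MN); rewrite absCE lecR; exact: HM.
Qed.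

Lemma compact_bounded_absC X : compact X -> bounded_absC X.
Proof.
move=> cX.
have [|N HN] := @compact_uniform R X (fun n x => absC x <= n%:R) cX _.
  move=> x Xx; exists (Num.truncn (absC x + 1)).+1, 1; split => // y n Xy yx Nn.
  have h := absC_dist y x.
  have := truncnS_gt (absC x + 1).
  have : ((Num.truncn (absC x + 1)).+1%:R : R) <= n%:R by rewrite ler_nat.
  by move: (_.+1%:R) n%:R => a b; lra.
by exists N%:R => z; exact: HN.
Qed.

Lemma outside_unbounded M : ~ bounded_absC (outside M).
Proof.
move=> [N HN]; pose x := `|M| + `|N| + 1.
have x0 : 0 <= x by rewrite !addr_ge0.
have := HN x%:C%C; rewrite absC_real ger0_norm // => H.
have : outside M x%:C%C.
  by left; rewrite /= ger0_norm //; have := ler_norm M; have := normr_ge0 N;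
    rewrite /x; lra.
by move=> /H; have := ler_norm N; have := normr_ge0 M; rewrite /x; lra.
Qed.

Lemma plane_unbounded : ~ bounded_absC [set: C].
Proof. by move=> [M HM]; apply: (@outside_unbounded 0); exists M => z _; exact: HM. Qed.

Lemma not_outside S : bounded_absC S -> exists2 M : R, 0 <= M & S `&` outside M = set0.
Proof.
move=> [M HM]; exists (Num.max M 0); first by rewrite le_max lexx orbT.
rewrite -subset0 => z [/HM zM]; rewrite /outside /= !gt_max.
by have := Re_le_absC z; have := Im_le_absC z; move=> h1 h2 [/andP[? ?]|/andP[? ?]];
  lra.
Qed.

Lemma square_bounded S M : (forall z, S z -> ~ outside M z) -> bounded_absC S.
Proof.
move=> H; exists (M + M) => z /H /not_orP[/negP + /negP]; rewrite -!leNgt => h1 h2.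
by apply: le_trans (absC_le_ReIm z) _; exact: lerD.
Qed.

(** Apply [unicoherent] in a square [K] whose interior contains [X]. The part
    of the complement of [D] in [K] is connected, since it is the image of the
    complement of [D] by the retraction of the plane onto [K]. *)
Lemma boundary_connected D X : open D -> compact X -> closure D `<=` X ->
  connected (closure D) -> connected (~` D) -> connected (closure D `&` ~` D).
Proof.
move=> oD cX DX cD cCD.
have [M M0 XM] := not_outside (compact_bounded_absC cX).
have inX z : X z -> `|complex.Re z| <= M /\ `|complex.Im z| <= M.
  move=> Xz; have : ~ outside M z by move=> oz; suff : set0 z by []; rewrite -XM.
  by move=> /not_orP[/negP + /negP]; rewrite -!leNgt.
pose r := M + 1; have r0 : 0 <= r by rewrite addr_ge0.
pose K : set C := sq 0 r.
have KE z : K z <-> - r <= complex.Re z <= r /\ - r <= complex.Im z <= r.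
  by rewrite /K /sq /rect /= !sub0r !add0r.
(* The retraction of the plane onto the square, coordinate by coordinate. *)
pose cl (x : R) : R := Num.max (- r) (Num.min r x).
pose ret z : C := (cl (complex.Re z) +i* cl (complex.Im z))%C.
have cl_id x : - r <= x <= r -> cl x = x.
  by move=> /andP[x1 x2]; rewrite /cl min_r // max_r.
have cl_in x : - r <= cl x <= r.
  by rewrite /cl le_max lexx /= ge_max ge_min lexx andbT; lra.
(* The retraction moves points outside the square to its boundary, away from
   [X]. *)
have cl_M x : `|cl x| <= M -> cl x = x.
  rewrite /cl ler_norml /r; case: (leP (M + 1) x) => h; last first.
    by case: (leP (- (M + 1)) x) => h2; rewrite ?(max_r h2) ?(max_l (ltW h2)) //; lra.
  by rewrite max_r; lra.
have c_cl : continuous (cl : R^o -> R^o).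
  move=> x; apply: (@continuous_max _ R^o (fun=> - r) (fun x => Num.min r x)).
    exact: cvg_cst.
  by apply: (@continuous_min _ R^o (fun=> r) (fun x => x));
    [exact: cvg_cst|exact: cvg_id].
have c_ret : continuous ret.
  move=> z; apply: (@continuous_Complex R C (fun z => cl (complex.Re z)) (fun z =>
    cl (complex.Im z)) z).
    by apply: (@continuous_comp _ _ _ (@complex.Re R : C -> R^o) cl);
      [exact: continuous_Re|exact: c_cl].
  by apply: (@continuous_comp _ _ _ (@complex.Im R : C -> R^o) cl);
    [exact: continuous_Im|exact: c_cl].
have QE : ret @` (~` D) = ~` D `&` K.
  apply/seteqP; split=> [_ [z nDz <-]|z [nDz /KE[h1 h2]]]; last first.
    by exists z => //; case: z h1 h2 nDz => a b /= h1 h2 _; rewrite /ret /= !cl_id.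
  split; last by apply/KE; split => /=; exact: cl_in.
  move=> Dr; apply: nDz; have := inX _ (DX _ (subset_closure Dr)) =>
    /= -[/cl_M h1 /cl_M h2].
  by move: Dr; rewrite /ret h1 h2; case: z {h1 h2}.
have cQ : connected (~` D `&` K).
  by rewrite -QE; apply: image_connected => // z _; exact: c_ret.
have clK : closed K.
  have -> : K = (@complex.Re R : C -> R) @^-1` `[- r, r]%classic `&` 
                (@complex.Im R : C -> R) @^-1` `[- r, r]%classic.
    by apply/seteqP; split=> z; rewrite /= !in_itv /= => h; apply/KE.
  apply: closedI; apply: closed_comp; try exact: itv_closed.
    by move=> z _; exact: continuous_Re.
  by move=> z _; exact: continuous_Im.
have DK : closure D `<=` K.
  move=> z /DX /inX[]; rewrite !ler_norml => /andP[? ?] /andP[? ?]; apply/KE.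
  by rewrite /r; split; apply/andP; split; lra.
have PQ : closure D `&` ~` D = closure D `&` (~` D `&` K).
  by rewrite setIA; apply/esym/setIidPl => z [/DK].
have clD : closed (~` D) by exact: open_closedC.
rewrite PQ; apply: (@unicoherent R K _ _ (r + r)) => //.
- move=> z w t /KE[/andP[a1 a2] /andP[a3 a4]] /KE[/andP[b1 b2] /andP[b3 b4]] /andP[t0
  t1].
  have conv (x y : R) : - r <= x -> x <= r -> - r <= y -> y <= r ->
    - r <= x + t * (y - x) <= r.
    move=> x1 x2 y1 y2.
    have h1 : 0 <= t * (y + r) by rewrite mulr_ge0 //; lra.
    have h2 : 0 <= t * (r - y) by rewrite mulr_ge0 //; lra.
    have h3 : 0 <= (1 - t) * (x + r) by rewrite mulr_ge0 //; lra.
    have h4 : 0 <= (1 - t) * (r - x) by rewrite mulr_ge0 //; lra.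
    by apply/andP; split; lra.
  apply/KE; case: z w a1 a2 a3 a4 b1 b2 b3 b4 => a b [a' b'] /= a1 a2 a3 a4 b1 b2 b3 b4.
  by rewrite !mul0r subr0 addr0; split; exact: conv.
- by apply: absC_sq; rewrite subrr absC0.
- by move=> z /sq_absC; rewrite subr0.
- exact: closed_closure.
- exact: closedI.
- rewrite -PQ; apply: (subclosed_compact _ cX); last by move=> z [/DX].
  by apply: closedI => //; exact: closed_closure.
- apply/seteqP; split=> [z [/DK//|[]//]|z Kz].
  by have [Dz|nDz] := pselect (D z); [left; exact: subset_closure|right].
Qed.

End PlaneTopology.

(** * Topological annuli and their images *)

Section Annulus.
Variable R : realType.
Local Notation C := R[i]^o.
Implicit Types (z w c : C) (A B D O S X : set C) (f : C -> C).

Lemma separated_closed S1 S2 : closed S1 -> closed S2 -> S1 `&` S2 = set0 ->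
  separated S1 S2.
Proof.
by move=> c1 c2 S12; rewrite /separated -((closure_id _).1 c1) -((closure_id _).1 c2).
Qed.

Lemma two_components S B1 B2 : S = B1 `|` B2 -> B1 `&` B2 = set0 ->
  closed B1 -> closed B2 -> connected B1 -> connected B2 -> B1 !=set0 -> B2 !=set0 ->
  components S = [set B1; B2].
Proof.
move=> SE B12 cl1 cl2 co1 co2 [x1 Bx1] [x2 Bx2].
have side B B' x : S = B `|` B' -> B `&` B' = set0 -> closed B -> closed B' ->
    connected B -> B x -> connected_component S x = B.
  move=> SE' dis clB clB' coB Bx; apply/seteqP; split; last first.
    by apply: connected_component_max => //; rewrite SE'; exact: subsetUl.
  have Sx : S x by rewrite SE'; left.
  have := connected_subset (separated_closed clB clB' dis) (C :=
    connected_component S x).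
  rewrite -SE' => /(_ (@connected_component_sub _ _ _)
    (@component_connected _ _ _)) [//|h].
  have : B' x by apply/h/connected_component_refl.
  by move=> B'x; suff : set0 x by []; rewrite -dis.
have SE' : S = B2 `|` B1 by rewrite setUC.
have B21 : B2 `&` B1 = set0 by rewrite setIC.
apply/seteqP; split => [_ [z Sz <-]|_ [->|->]].
- move: (Sz); rewrite SE => -[Bz|Bz]; [left|right].
    by rewrite -SE (side _ _ _ SE B12 cl1 cl2 co1 Bz).
  by rewrite -SE (side _ _ _ SE' B21 cl2 cl1 co2 Bz).
- by exists x1; [rewrite SE; left|exact: side SE B12 cl1 cl2 co1 Bx1].
- by exists x2; [rewrite SE; right|exact: side SE' B21 cl2 cl1 co2 Bx2].
Qed.

Lemma components_two S B1 B2 : closed S -> components S = [set B1; B2] -> B1 <> B2 ->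
  [/\ S = B1 `|` B2, B1 `&` B2 = set0 &
   forall B, B = B1 \/ B = B2 -> [/\ closed B, connected B & B !=set0]].
Proof.
move=> clS SE B12.
have all B : B = B1 \/ B = B2 -> exists2 x, S x & connected_component S x = B.
  by move=> h; have : components S B; [rewrite SE|case=> x Sx <-; exists x].
split.
- have := connected_component_cover S; rewrite -/(components S) SE.
  by move=> <-; rewrite bigcup_setU !bigcup_set1.
- have [x1 Sx1 e1] := all B1 (or_introl erefl); have [x2 Sx2 e2] :=
  all B2 (or_intror erefl).
  rewrite -subset0 => z [z1 z2]; apply: B12.
  rewrite -e1 -e2; move: z1 z2; rewrite -e1 -e2 => z1 z2.
  by rewrite (same_connected_component z1) (same_connected_component z2).
- move=> B /all[x Sx <-]; split; [exact: component_closed|exact: component_connected|].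
  by exists x; exact: connected_component_refl.
Qed.

(** [A] is a bounded topological annulus, [B] and [O] are the bounded and the
    unbounded component of its complement. *)
Record annular A B O : Prop := Annular {
  ann_open : open A;
  ann_neq0 : A !=set0;
  ann_connected : connected A;
  ann_compl : ~` A = B `|` O;
  ann_disjoint : B `&` O = set0;
  ann_in_closed : closed B;
  ann_out_closed : closed O;
  ann_in_connected : connected B;
  ann_out_connected : connected O;
  ann_in_neq0 : B !=set0;
  ann_in_bounded : bounded_absC B;
  ann_out_unbounded : ~ bounded_absC O }.

Lemma unbounded_neq0 S : ~ bounded_absC S -> S !=set0.
Proof.
move=> nb; apply: contrapT => n0; apply: nb; exists 0 => z Sz.
by exfalso; apply: n0; exists z.
Qed.

Lemma bounded_absCS S1 S2 : S1 `<=` S2 -> bounded_absC S2 -> bounded_absC S1.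
Proof. by move=> S12 [M HM]; exists M => z /S12; exact: HM. Qed.

Lemma annular_components A B O : annular A B O -> components (~` A) = [set B; O].
Proof.
move=> [_ _ _ AE dis clB clO coB coO B0 _ uO]; apply: two_components => //.
exact: unbounded_neq0.
Qed.

Lemma annular_doubly_connected A B O : annular A B O -> doubly_connected A.
Proof.
move=> h; have cE := annular_components h; case: h => oA A0 coA _ _ _ _ _ _ _ bB uO.
by split=> //; exists B, O; split=> // BO; apply: uO; rewrite -BO.
Qed.

Lemma annular_bounded_component A B O : annular A B O -> bounded_component A = B.
Proof.
move=> h; have cE := annular_components h; case: h => _ _ _ _ _ _ _ _ _ _ bB uO.
apply/seteqP; split => [z [D [+ bD] Dz]|z Bz].
  rewrite cE => -[<-//|DO]; exfalso; apply: uO; rewrite -DO; exact/bounded_absCP.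
by exists B => //; split; [rewrite cE; left|exact/bounded_absCP].
Qed.

(** The complement of a large square is connected and misses [A], so it lies
    in one of the two components of the complement of [A]; this one is
    unbounded, the other one is bounded. *)
Lemma doubly_connected_annular A : doubly_connected A -> bounded_absC A ->
  exists B O, annular A B O.
Proof.
move=> [oA A0 coA [B1 [B2 [B12 cE]]]] /not_outside[M M0 AM].
have clA : closed (~` A) by exact: open_closedC.
have [AE dis H] := components_two clA cE B12.
have [cl1 co1 n1] := H _ (or_introl erefl); have [cl2 co2 n2] := H _ (or_intror erefl).
have OA : outside M `<=` ~` A by move=> z Mz Az; suff : set0 z by []; rewrite -AM.
have main B O : ~` A = B `|` O -> B `&` O = set0 -> closed B -> closed O ->
  connected B ->
    connected O -> B !=set0 -> outside M `<=` O -> annular A B O.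
  move=> AE' dis' clB clO coB coO B0 MO; split=> //.
    apply: (@square_bounded _ _ M) => z Bz /MO Oz; suff : set0 z by [];
      by rewrite -dis'.
  by move=> /(bounded_absCS MO); exact: outside_unbounded.
have := connected_subset (separated_closed cl1 cl2 dis) (C := outside M).
rewrite -AE => /(_ OA (outside_connected M0))[h|h].
  by exists B2, B1; apply: main => //; rewrite 1?setUC // setIC.
by exists B1, B2; apply: main.
Qed.

Lemma annular_in_sub A B O : annular A B O -> forall z, B z -> ~ A z.
Proof. by move=> h z Bz; have : (~` A) z by rewrite (ann_compl h); left. Qed.

Lemma annular_fill A B O : annular A B O -> A `|` B = ~` O.
Proof.
move=> h; apply/seteqP; split=> z.
  move=> [Az Oz|Bz Oz]; first by have : (~` A) z by [rewrite (ann_compl h); right].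
  by suff : set0 z by []; rewrite -(ann_disjoint h).
move=> nOz; have [Az|nAz] := pselect (A z); first by left.
by right; have : (~` A) z by []; rewrite (ann_compl h) => -[].
Qed.

(** The plane being connected, the closed sets [B] and [closure A `|` O] that
    cover it intersect; thus the closure of [A] meets [B]. *)
Lemma annular_fill_closure A B O : annular A B O -> connected (closure (A `|` B)).
Proof.
move=> h; rewrite closureU -((closure_id _).1 (ann_in_closed h)); apply: connectedU.
- have [||||| z [_ [Bz [cAz|Oz]]]] :=
  @connected_meet _ [set: C] B (closure A `|` O) (@plane_connected R).
  + exact: ann_in_closed h.
  + by apply: closedU; [exact: closed_closure|exact: ann_out_closed h].
  + move=> z _; have [Az|nAz] := pselect (A z); first by right; left;
    exact: subset_closure.
    have : (~` A) z by []; rewrite (ann_compl h) => -[]; [by left|by right; right].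
  + by have [x Bx] := ann_in_neq0 h; exists x.
  + by have [x Ax] := ann_neq0 h; exists x; split=> //; left; exact: subset_closure.
  + by exists z.
  + by suff : set0 z by []; rewrite -(ann_disjoint h).
- by apply: connected_closure; exact: ann_connected h.
- exact: ann_in_connected h.
Qed.

(** The boundary of [f @` D] is [S0], the image of the boundary of [D], and it
    is connected by [boundary_connected]. A part of the complement of [f @` D]
    that is open and closed in it and misses [S0] is open and closed in the
    plane, so it is empty. *)
Lemma image_compl_connected D X f : open D -> D !=set0 -> compact X ->
  closure D `<=` X ->
  connected (closure D) -> connected (~` D) ->
  continuous_pts X f -> (forall z w, X z -> X w -> f z = f w -> z = w) ->
  open (f @` D) -> connected (~` (f @` D)).
Proof.
move=> oD [x0 Dx0] cX DX cD cCD cf fI oW.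
have cbd := boundary_connected oD cX DX cD cCD.
have ccl : compact (f @` closure D).
  apply: image_compact; first exact: continuous_pts_sub cf.
  by apply: subclosed_compact cX DX; exact: closed_closure.
pose S0 := f @` (closure D `&` ~` D).
have cS0 : connected S0.
  by apply: image_connected => //; apply: continuous_pts_sub cf => z [/DX].
set K := ~` (f @` D).
have clK : closed K by exact: open_closedC.
have empty G : (exists2 V1, open V1 & G = K `&` V1) -> (exists2 V2, closed V2 &
  G = K `&` V2) ->
    G `&` S0 = set0 -> G = set0.
  move=> [V1 oO1 GO] [V2 cC1 GC] GS.
  have clG : closed G by rewrite GC; exact: closedI.
  have GE : G = V1 `&` ~` (f @` closure D).
    apply/seteqP; split=> [x Gx|x [Ox nx]]; last first.
      by rewrite GO; split=> // -[y Dy yx]; apply: nx; exists y => //;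
        exact: subset_closure.
    move: (Gx); rewrite GO => -[Kx Ox]; split=> // -[y Dy yx].
    have [Dy'|nDy] := pselect (D y); first by apply: Kx; exists y.
    by suff : set0 x by []; rewrite -GS; split=> //; exists y.
  have oG : open G.
    by rewrite GE; apply: openI => //; apply: closed_openC; exact: compact_closedC.
  apply: contrapT => /eqP/set0P G0.
  have := @plane_connected R G G0.
  move=> /(_ (ex_intro2 _ _ G oG (esym (setTI G)))).
  move=> /(_ (ex_intro2 _ _ G clG (esym (setTI G)))) GT.
  have : K (f x0) by have : G (f x0) by [rewrite GT]; rewrite GO => -[].
  by apply; exists x0.
move=> G G0 [V1 oO1 GO] [V2 cC1 GC].
have S0K : S0 `<=` K.
  move=> _ [y [Dy nDy] <-] [y' Dy' yy']; apply: nDy.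
  by rewrite -(fI _ _ (DX _ (subset_closure Dy')) (DX _ Dy) yy').
have [GS|GS] := pselect (G `&` S0 !=set0); last first.
  have GS0 : G `&` S0 = set0 by apply/eqP; apply: contra_notT GS => /set0P.
  have GE : G = set0 by apply: empty => //; [exists V1|exists V2].
  by case: G0; rewrite GE.
have SG : S0 `&` G = S0.
  apply: cS0; first by rewrite setIC.
    by exists V1 => //; rewrite GO setIA (setIidl S0K).
  by exists V2 => //; rewrite GC setIA (setIidl S0K).
have KG : K `&` ~` G = set0.
  apply: empty.
  - exists (~` V2); first exact: closed_openC.
    by rewrite GC setCI setIUr setICr set0U.
  - exists (~` V1); first exact: open_closedC.
    by rewrite GO setCI setIUr setICr set0U.
  - by rewrite -subset0 => z [[_ nG]]; rewrite -SG => -[].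
apply/seteqP; split=> z; first by rewrite GO => -[].
by move=> Kz; apply: contrapT => nG; suff : set0 z by []; rewrite -KG.
Qed.

Theorem annular_image A B O X f : annular A B O -> compact X -> A `|` B `<=` X ->
  continuous_pts X f -> (forall z w, X z -> X w -> f z = f w -> z = w) ->
  open (f @` A) -> open (f @` (A `|` B)) ->
  annular (f @` A) (f @` B) (~` (f @` (A `|` B))).
Proof.
move=> h cX ABX cf fI oA oAB.
have [AX BX] : A `<=` X /\ B `<=` X by split=> z ?; apply: ABX; [left|right].
have cfX := image_compact cf cX.
have bX := compact_bounded_absC cfX.
have fD : A `|` B = ~` O := annular_fill h.
have oD : open (A `|` B) by rewrite fD; apply: closed_openC; exact: ann_out_closed h.
have clX : closure (A `|` B) `<=` X.
  by rewrite [X in _ `<=` X](closure_id X).1; [exact: closureS|exact: compact_closedC].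
split.
- exact: oA.
- by have [x Ax] := ann_neq0 h; exists (f x); exists x.
- by apply: image_connected; [exact: continuous_pts_sub cf|exact: ann_connected h].
- apply/seteqP; split=> z.
    move=> nz; have [[x Bx xz]|nB] := pselect ((f @` B) z); first by left; exists x.
    by right=> -[x [Ax|Bx] xz]; [apply: nz|apply: nB]; exists x.
  move=> [[x Bx <-]|nz] [y Ay yz]; last by apply: nz; exists y => //; left.
  apply: (annular_in_sub h Bx); rewrite -(fI y x) //; [exact: AX|exact: BX].
- by rewrite -subset0 => _ [[x Bx <-]]; apply; exists x => //; right.
- apply: compact_closedC; apply: image_compact; first exact: continuous_pts_sub cf.
  by apply: subclosed_compact cX BX; exact: ann_in_closed h.
- exact: open_closedC.
- by apply: image_connected; [exact: continuous_pts_sub cf|exact: ann_in_connected h].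
- apply: (image_compl_connected oD _ cX clX) => //.
  + by have [x Ax] := ann_neq0 h; exists x; left.
  + exact: annular_fill_closure h.
  + by rewrite fD setCK; exact: ann_out_connected h.
- by have [x Bx] := ann_in_neq0 h; exists (f x); exists x.
- by apply: bounded_absCS bX; exact: image_subset.
- move=> [M HM]; case: bX => N HN; apply: (@plane_unbounded R).
  exists (Num.max M N) => z _; have [[x Dx <-]|nz] := pselect ((f @` (A `|` B)) z).
    by rewrite le_max (HN _) ?orbT //; exists x => //; exact: ABX.
  by rewrite le_max HM.
Qed.

End Annulus.

(** * Conformal images of annuli *)

Section Derivable.
Variable R : realType.
Local Notation C := R[i]^o.
Implicit Types (z w : C) (f g h : C -> C) (A U : set C).

Lemma derivable_holo f z : derivable f z 1 <-> holo_at f z.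
Proof.
split=> [/cvg_ex[/= l /(cvgC (FF := dnbhs_filter _))  fl]|[q cq fE]].
  exists (fun w => if w == z then l else (f w - f z) / (w - z)); last first.
    by move=> w; case: eqVneq => [->|wz];
      [rewrite subrr mulr0 addr0|rewrite divfK ?subr_eq0 // addrC subrK].
  apply/contC => e e0; have /nbhsC[d d0 Hd] := fl e e0.
  exists d => // w wd; rewrite eqxx; case: eqVneq => [_|wz];
    first by rewrite subrr absC0.
  have := Hd (w - z); rewrite subr0 => /(_ wd); rewrite subr_eq0 => /(_ wz) /=.
  by rewrite [_ *: 1]mulr1 subrK mulrC.
apply/cvg_ex; exists (q z); apply/(cvgC (FF := dnbhs_filter _)) => e e0.
have [d d0 Hd] := (contC q z).1 cq e e0.
apply/nbhsC; exists d => // h; rewrite subr0 => hd h0 /=.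
rewrite [_ *: 1]mulr1 (fE (h + z)) [f z + _]addrC addrK addrK [_ *: _]mulrC mulfK //.
by apply: Hd; rewrite addrK.
Qed.

Lemma conformal_holo U f : conformal_on U f <-> (forall z, U z -> holo_at f z) /\ 
  (forall z w, U z -> U w -> f z = f w -> z = w).
Proof.
split=> -[df fI]; split.
- by move=> z Uz; apply/derivable_holo; exact: df.
- by move=> z w Uz Uw; apply: fI; rewrite inE.
- by move=> z Uz; apply/derivable_holo; exact: df.
- by move=> z w /set_mem Uz /set_mem Uw; exact: fI.
Qed.

Lemma conformal_sub A U f : A `<=` U -> conformal_on U f -> conformal_on A f.
Proof.
move=> AU /conformal_holo[df fI]; apply/conformal_holo; split =>
  [z /AU|z w /AU Uz /AU Uw].
  exact: df.
exact: fI.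
Qed.

Lemma conformal_comp A f g : conformal_on A f -> conformal_on (f @` A) g ->
  conformal_on A (fun z => g (f z)).
Proof.
move=> /conformal_holo[df fI] /conformal_holo[dg gI]; apply/conformal_holo; split.
  by move=> z Az; apply: (holo_comp (df z Az)); apply: dg; exists z.
move=> z w Az Aw /gI fzw; apply: fI => //; apply: fzw; [by exists z|by exists w].
Qed.

Lemma conformal_inverse A f : open A -> conformal_on A f ->
  open (f @` A) /\ exists g, [/\ conformal_on (f @` A) g, g @` (f @` A) = A &
    forall z, A z -> g (f z) = z].
Proof.
move=> oA /conformal_holo[df fI].
pose g w := xget 0 [set z | A z /\ f z = w].
have gf z : A z -> g (f z) = z.
  move=> Az; rewrite /g; case: xgetP => [y _ [Ay fy]|/(_ z) []//].
  exact: fI.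
split; first exact: (image_open oA df gf).
exists g; split=> //.
  apply/conformal_holo; split=> [_ [z Az <-]|_ _ [z Az <-] [w Aw <-]].
    exact: (inverse_holo oA df gf Az).
  by rewrite !gf // => ->.
apply/seteqP; split=> [_ [_ [z Az <-] <-]|z Az]; first by rewrite gf.
by exists (f z); [exists z|rewrite gf].
Qed.

(** Compose with [f] or with its inverse. *)
Lemma maps_onto_round_image A f w r s : open A -> conformal_on A f ->
  maps_onto_round_annulus (f @` A) w r s <-> maps_onto_round_annulus A w r s.
Proof.
move=> oA cf; have [_ [g [cg gA gf]]] := conformal_inverse oA cf.
split=> -[h [ch hE]].
  exists (fun z => h (f z)); split; first exact: conformal_comp.
  by rewrite -hE -image_comp.
exists (fun z => h (g z)); split; first by apply: conformal_comp => //; rewrite gA.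
by rewrite -hE -[X in _ = _ @` X]gA [RHS]image_comp.
Qed.

Lemma modulus_image A f : open A -> conformal_on A f -> modulus (f @` A) = modulus A.
Proof.
move=> oA cf; rewrite /modulus; congr (xget 0 _); apply/seteqP.
by split=> m [w [r [s [r0 rs h ->]]]]; exists w, r, s; split => //;
  apply/(maps_onto_round_image _ _ _ oA cf).
Qed.

Lemma conformal_annulus_image A B O U X f : conformal_annulus A -> annular A B O ->
  compact X -> A `|` B `<=` X -> X `<=` U -> conformal_on U f ->
  conformal_annulus (f @` A) /\ annular (f @` A) (f @` B) (~` (f @` (A `|` B))).
Proof.
move=> [_ [w [r [s [r0 rs h]]]]] an cX ABX XU cf.
have AU : A `<=` U by move=> z Az; apply/XU/ABX; left.
have oAB : open (A `|` B).
  by rewrite (annular_fill an); apply: closed_openC; exact: ann_out_closed an.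
have cfA := conformal_sub AU cf.
have cfAB := conformal_sub (subset_trans ABX XU) cf.
have an' : annular (f @` A) (f @` B) (~` (f @` (A `|` B))).
  have [df fI] := (conformal_holo U f).1 cf.
  apply: (annular_image an cX ABX).
  - by move=> z /XU /df; exact: holo_cts.
  - by move=> z v /XU Uz /XU Uv; exact: fI.
  - by case: (conformal_inverse (ann_open an) cfA).
  - by case: (conformal_inverse oAB cfAB).
split=> //; split; first exact: annular_doubly_connected an'.
by exists w, r, s; split=> //; apply/(maps_onto_round_image _ _ _ (ann_open an) cfA).
Qed.

End Derivable.

(** * Cylinders of a non-autonomous system *)

Section NIFS.
Variable R : realType.
Local Notation C := R[i]^o.
Variables (U X : set C) (I : nat -> Type) (phi : forall j, I j -> C -> C).
Hypothesis hPhi : is_conformal_NIFS U X phi.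
Implicit Types (x y z : C).

Let cX : compact X := nifs_compact hPhi.1.
Let XU : X `<=` U := nifs_subset hPhi.1.
Let phiX j (i : I j) z : U z -> X (phi i z).
Proof. exact: nifs_maps hPhi.1 _ i z. Qed.

Lemma nifs_target_neq0 : X !=set0.
Proof.
have [z Uz] := nifs_nonempty hPhi.1; have [ i ] := nifs_inhabited hPhi.1 0%N.
by exists (phi i z); exact: phiX.
Qed.

Lemma phi_cts j (i : I j) : continuous_pts X (phi i).
Proof.
move=> z Xz; have [df _] := (conformal_holo U (phi i)).1 (hPhi.2 j i).
by apply/holo_cts/df/XU.
Qed.

Lemma phi_connected j (i : I j) : connected X -> connected (phi i @` X).
Proof. by apply: image_connected; exact: phi_cts. Qed.

Lemma word_map_in k (w : word I k) z : X z -> X (word_map phi w z).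
Proof.
elim: k w z => [//|k IH] w z Xz /=; apply: IH; exact/phiX/XU.
Qed.

Lemma word_map_conformal k (w : word I k) : conformal_on U (word_map phi w).
Proof.
elim: k w => [|k IH] w /=.
  by apply/conformal_holo; split => // z _; exact: holo_id.
apply: (conformal_comp (hPhi.2 k (w ord_max))).
by apply: conformal_sub (IH _) => _ [z Uz <-]; exact/XU/phiX.
Qed.

Lemma word_map_cts k (w : word I k) : continuous_pts X (word_map phi w).
Proof.
move=> z Xz; have [df _] := (conformal_holo U _).1 (word_map_conformal w).
by apply/holo_cts/df/XU.
Qed.

(** Words of the same length are read from the first letter on: by strong
    separation letters that lead to a common point are equal, and then
    injectivity removes them. *)
Lemma word_map_cancel k (w w' : word I k) x x' : strong_separation X phi ->
  X x -> X x' -> word_map phi w x = word_map phi w' x' -> x = x'.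
Proof.
move=> ssc; elim: k w w' x x' => [//|k IH] w w' x x' Xx Xx' /= /IH E.
have {}E := E (phiX _ (XU Xx)) (phiX _ (XU Xx')).
have ww : w ord_max = w' ord_max.
  apply: contrapT => /(@ssc k) dis.
  suff : set0 (phi (w ord_max) x) by [].
  by rewrite -dis; split; [exists x|rewrite E; exists x'].
move: E; rewrite ww.
have [_ fI] := (conformal_holo U _).1 (hPhi.2 k (w' ord_max)).
by apply: fI; exact: XU.
Qed.

Definition cylinder (omega : forall k, I k) n := word_map phi (truncate omega n) @` X.

Lemma cylinderS omega n : cylinder omega n.+1 `<=` cylinder omega n.
Proof.
move=> _ [z Xz <-]; exists (phi (omega n) z) => //; exact/phiX/XU.
Qed.

Lemma cylinder_le omega m n : (m <= n)%N -> cylinder omega n `<=` cylinder omega m.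
Proof.
move=> /subnK <-; elim: (n - m)%N => [|k IH]; first by rewrite add0n.
by rewrite addSn; apply: subset_trans IH; exact: cylinderS.
Qed.

(** The cylinders of a code are compact, not empty and decreasing. *)
Lemma code_point omega : exists p, forall n, cylinder omega n p.
Proof.
apply: contrapT => /forallNP np.
have [x Xx|N HN] := @compact_uniform R X (fun n x => ~ cylinder omega n x) cX _.
  have /existsNP[n nx] := np x.
  have cl : closed (cylinder omega n).
    apply: compact_closedC; apply: image_compact => //; exact: word_map_cts.
  have /nbhsC[e e0 He] : nbhs x (~` cylinder omega n).
    by apply: open_nbhs_nbhs; split => //; exact: closed_openC.
  by exists n, e; split=> // y m Xy yx nm /(cylinder_le nm); exact: He.
have [x Xx] := nifs_target_neq0.
have Xp : X (word_map phi (truncate omega N) x) by exact: word_map_in.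
by apply: (HN N (leqnn N) _ Xp); exists x.
Qed.

Lemma cylinder_limit_set omega p : (forall n, (0 < n)%N -> cylinder omega n p) ->
  limit_set X phi p.
Proof.
move=> H k k0; have [x Xx xp] := H k k0.
by exists (truncate omega k) => //; exists x.
Qed.

Lemma projection_cylinder omega n : (0 < n)%N ->
  cylinder omega n (projection X phi omega).
Proof.
move=> n0; rewrite /projection; case: xgetP => [p _ /(_ n n0)//|np].
by have [p Hp] := code_point omega; case: (np p) => k k0; exact: Hp.
Qed.

Section Contraction.
Variables (s : R) (d : C -> C -> R).
Hypotheses (s0 : 0 < s) (s1 : s < 1) (dm : metric_on U d) (dt : induces_topology_on X d)
  (dc : forall j (i : I j) z w, X z -> X w -> d (phi i z) (phi i w) <= s * d z w).

Let d_tri x y z : X x -> X y -> X z -> d x z <= d x y + d y z.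
Proof. by case: dm => _ _ _ H /XU ? /XU ? /XU ?; exact: H. Qed.

Let d_xx x : X x -> d x x = 0.
Proof. by case: dm => _ H _ _ /XU Ux; apply/(H x x Ux Ux). Qed.

(** Balls of the metric [d] are open in [X], as [d] induces the topology of
    [X]. *)
Lemma d_ball_nbhs x y (r : R) : X x -> X y -> d x y < r ->
  exists2 e : R, 0 < e & forall z, X z -> absC (z - y) < e -> d x z < r.
Proof.
move=> Xx Xy xyr.
have [V oV VE] : exists2 V : set C, open V & [set z | X z /\ d x z < r] = V `&` X.
  apply: (dt (V := [set z | X z /\ d x z < r]) _).2; first by move=> z [].
  move=> z [Xz xz]; exists (r - d x z); first by rewrite subr_gt0.
  by move=> t [Xt zt]; split=> //; have := d_tri Xx Xz Xt; lra.
have /nbhsC[e e0 He] : nbhs y V.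
  by apply: open_nbhs_nbhs; split => //; have [] : (V `&` X) y by rewrite -VE.
exists e => // z Xz zy; have [//] : [set z | X z /\ d x z < r] z.
by rewrite VE; split=> //; exact: He.
Qed.

Lemma d_bounded : exists2 M : R, 0 < M & forall x y, X x -> X y -> d x y <= M.
Proof.
have [x0 Xx0] := nifs_target_neq0.
have [x Xx|N HN] := @compact_uniform R X (fun n x => d x0 x < n%:R) cX _.
  have lt : d x0 x < (Num.truncn (d x0 x)).+1%:R by exact: truncnS_gt.
  have [e e0 He] := d_ball_nbhs Xx0 Xx lt.
  exists (Num.truncn (d x0 x)).+1, e; split=> // y n Xy yx Nn.
  by apply: lt_le_trans (He y Xy yx) _; rewrite ler_nat.
have dC x y : X x -> X y -> d x y = d y x.
  by case: dm => _ _ H _ /XU ? /XU ?; exact: H.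
have N0 : 0 <= N%:R :> R by [].
exists (N%:R + N%:R + 1); first by rewrite ltr_wpDl // addr_ge0.
move=> x y Xx Xy; have := d_tri Xx Xx0 Xy; have := HN N (leqnn N) x Xx.
by have := HN N (leqnn N) y Xy; rewrite (dC x x0) //; lra.
Qed.

(** The identity of [X], from the metric [d] to the Euclidean one, is
    continuous and so uniformly continuous by compactness. *)
Lemma d_uniform (e : R) : 0 < e -> exists2 eta : R, 0 < eta &
  forall x y, X x -> X y -> d x y < eta -> absC (x - y) < e.
Proof.
move=> e0; have e2 : 0 < e / 2 by rewrite divr_gt0.
have [x Xx|N HN] := @compact_uniform R X
   (fun n x => forall y, X y -> d x y < n.+1%:R^-1 -> absC (x - y) < e) cX _;
     last first.
  by exists N.+1%:R^-1; [rewrite invr_gt0|move=> x y Xx Xy; exact: HN].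
pose V : set C := [set y | absC (y - x) < e / 2] `&` X.
have [r r0 Hr] : exists2 r : R, 0 < r & [set y | X y /\ d x y < r] `<=` V.
  apply: (dt (V := V) _).1; first by move=> z [].
    exists [set y | absC (y - x) < e / 2] => //; rewrite openE => y /= yx; apply/nbhsC.
    exists (e / 2 - absC (y - x)); first by rewrite subr_gt0.
    by move=> z zy /=; have := absC_tri y z x; lra.
  by split=> //; rewrite /= subrr absC0.
have r2 : 0 < r / 2 by rewrite divr_gt0.
have xx : d x x < r / 2 by rewrite d_xx.
have [t t0 Ht] := d_ball_nbhs Xx Xx xx.
have [M HM] := invn_lt r2.
exists M, t; split=> // y n Xy yx /HM nr2 z Xz yz.
have xy := Ht y Xy yx; have yz2 := lt_trans yz nr2.
have [Vy _] : V y by apply: Hr; split=> //; lra.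
have [Vz _] : V z by apply: Hr; split=> //; have := d_tri Xx Xy Xz; lra.
move: Vy Vz => /= Vy Vz; have := absC_tri x y z; rewrite [absC (x - z)]absC_distC; lra.
Qed.

Lemma word_map_contract k (w : word I k) x y : X x -> X y ->
  d (word_map phi w x) (word_map phi w y) <= s ^+ k * d x y.
Proof.
elim: k w x y => [|k IH] w x y Xx Xy /=; first by rewrite expr0 mul1r.
apply: le_trans (IH _ _ _ _ _) _; [exact/phiX/XU|exact/phiX/XU|].
rewrite exprSr -mulrA; apply: ler_wpM2l; [exact/exprn_ge0/ltW|exact: dc].
Qed.

Lemma word_map_small_metric (e : R) : 0 < e -> exists N, forall k, (N <= k)%N ->
  forall (w : word I k) x y, X x -> X y ->
    absC (word_map phi w x - word_map phi w y) < e.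
Proof.
move=> e0; have [eta eta0 Heta] := d_uniform e0; have [M M0 HM] := d_bounded.
have := @cvg_geometric R M s; rewrite ger0_norm ?ltW // => /(_ s1).
move=> /cvgrPdist_lt /(_ eta eta0) [N _ HN]; exists N => k /HN.
rewrite sub0r normrN /geometric /= => Mk w x y Xx Xy; apply: Heta;
  try exact: word_map_in.
apply: le_lt_trans (word_map_contract w Xx Xy) _; apply: le_lt_trans Mk.
apply: le_trans (ler_norm _); rewrite mulrC; apply: ler_wpM2r;
  [exact/exprn_ge0/ltW|exact: HM].
Qed.

End Contraction.

Lemma word_map_small (e : R) : 0 < e -> exists N, forall k, (N <= k)%N ->
  forall (w : word I k) x y, X x -> X y ->
    absC (word_map phi w x - word_map phi w y) < e.
Proof.
have [s [d [s0 s1 dm dt dc]]] := nifs_contraction hPhi.1.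
exact: (word_map_small_metric s0 s1 dm dt).
Qed.

End NIFS.

(** * Thinness of the limit set *)

Lemma diameter_cvg0 (R : realType) (A : nat -> set R[i]^o) : (forall n, A n !=set0) ->
  (forall e : R, 0 < e -> exists N, forall n, (N <= n)%N -> forall z w, A n z ->
    A n w -> absC (z - w) < e) ->
  diameter (A n) @[n --> \oo] --> 0%E.
Proof.
move=> A0 H.
have bnd (e : R) : 0 < e -> exists N, forall n, (N <= n)%N ->
  (0 <= diameter (A n) <= e%:E)%E.
  move=> e0; have [N HN] := H e e0; exists N => n Nn; apply/andP; split.
    have [x Ax] := A0 n; apply: ereal_sup_ubound; exists x => //; exists x => //.
    by rewrite -[complex.Re _]/(absC (x - x)) subrr absC0.
  by apply: ge_ereal_sup => _ [z Az [w Aw <-]]; rewrite lee_fin; exact/ltW/(HN n).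
apply/fine_cvgP; split.
  have [N HN] := bnd 1 ltr01; exists N => // n /HN /andP[h1 h2].
  by rewrite fin_numElt (lt_le_trans _ h1) ?ltNyr //= (le_lt_trans h2) // ltry.
apply/cvgrPdist_le => e e0; have [N HN] := bnd e e0; exists N => // n /HN /andP[h1 h2].
rewrite sub0r normrN ger0_norm ?fine_ge0 //.
by rewrite -[e]/(fine e%:E) fine_le // fin_numElt ?ltry ?ltNyr //
  (lt_le_trans _ h1) ?ltNyr //= (le_lt_trans h2) // ltry.
Qed.

Theorem theorem1p3 (R : realType) (U X : set R[i]^o) (I : nat -> Type)
  (phi : forall j, I j -> R[i]^o -> R[i]^o)
  (hPhi : is_conformal_NIFS U X phi)
  (hX : connected X)
  (hSSC : strong_separation X phi)
  (j : nat -> nat)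
  (hj : forall n n', (n < n')%N -> (j n < j n')%N)
  (A : nat -> set R[i]^o)
  (hA : forall n, conformal_annulus (A n))
  (hAX : forall n, A n `<=` X /\ bounded_component (A n) `<=` X)
  (hsep : forall n, separates (A n) (first_level X phi (j n)))
  (hmod : modulus (A n) @[n --> \oo] --> +oo) :
  (forall n, exists i : I (j n), phi (j n) i @` X `<=` bounded_component (A n)) /\
  (forall (m : forall n, I (j n)) (omega : forall k, I k),
     (forall n, phi (j n) (m n) @` X `<=` bounded_component (A n)) ->
     (forall n, omega (j n) = m n) ->
     pointwise_thin (limit_set X phi) (projection X phi omega)).
Proof.
have cX := nifs_compact hPhi.1; have XU := nifs_subset hPhi.1.
have phiX k (i : I k) z : X z -> X (phi k i z) by move=> /XU;
  exact: nifs_maps hPhi.1 k i z.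
have an n : exists Q, annular (A n) (bounded_component (A n)) Q.
  have bA : bounded_absC (A n) by apply: bounded_absCS (hAX n).1 _;
    exact: compact_bounded_absC.
  have [B [Q h]] := doubly_connected_annular (hA n).1 bA.
  by exists Q; rewrite (annular_bounded_component h).
(* A piece of the first level is connected and misses [A n], so it lies on one
   side of it. *)
have piece n Q (S : set R[i]^o) (i : I (j n)) : annular (A n) (bounded_component
  (A n)) Q ->
    S = bounded_component (A n) \/ S = Q -> phi (j n) i @` X `&` S !=set0 ->
      phi (j n) i @` X `<=` S.
  move=> h SE [x [ix Sx]].
  have sub : phi (j n) i @` X `<=` bounded_component (A n) `|` Q.
    move=> y iy; rewrite -(ann_compl h) => Ay; suff : set0 y by [].
    by rewrite -(hsep n).1; split=> //; exists i.
  have dis := ann_disjoint h.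
  have sep := separated_closed (ann_in_closed h) (ann_out_closed h) dis.
  have [h'|h'] := connected_subset sep sub (@phi_connected _ _ _ _ _ hPhi _ i hX);
    case: SE => SE; rewrite SE //.
    by suff : set0 x by []; rewrite -dis; split; [exact: h'|rewrite -SE].
  by suff : set0 x by []; rewrite -dis; split; [rewrite -SE|exact: h'].
have meet n Q (S : set R[i]^o) : annular (A n) (bounded_component (A n)) Q ->
    S = bounded_component (A n) \/ S = Q -> exists i : I (j n), phi (j n) i @` X `<=` S.
  move=> h SE; have : components (~` A n) S by rewrite (annular_components h).
  by move=> /(hsep n).2[x [[i _ ix] Sx]]; exists i; apply: (piece n Q) => //; exists x.
split.
  by move=> n; have [Q h] := an n; apply: (meet n Q) => //; left.
move=> m omega hm homega.
have jn n : (n <= j n)%N.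
  by elim: n => // n IH; apply: leq_ltn_trans IH _; exact: hj.
pose f n := word_map phi (truncate omega (j n)).
have img n Q : annular (A n) (bounded_component (A n)) Q ->
    conformal_annulus (f n @` A n) /\
    annular (f n @` A n) (f n @` bounded_component (A n)) (~` (f n @`
      (A n `|` bounded_component (A n)))).
  move=> h; apply: (conformal_annulus_image (hA n) h cX _ XU).
    by move=> z [] ?; [exact: (hAX n).1|exact: (hAX n).2].
  exact: (word_map_conformal hPhi).
have proj_in n : (f n @` bounded_component (A n)) (projection X phi omega).
  have [x Xx <-] := projection_cylinder hPhi omega (ltn0Sn (j n)).
  by exists (phi (j n) (omega (j n)) x) => //; apply: (hm n); rewrite -homega; exists x.
have projJ : limit_set X phi (projection X phi omega).
  by apply: (cylinder_limit_set (omega := omega)) => n;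
    exact: (projection_cylinder hPhi).
split=> //; exists (fun n => f n @` A n); split.
- move=> n; have [Q h] := an n; have [ca an'] := img n Q h; split=> //.
    split.
      rewrite -subset0 => z [/(_ (j n).+1 (ltn0Sn _))[w _ [y Xy <-]] [a Aa /= aE]].
      have Xa := (hAX n).1 a Aa.
      have := word_map_cancel hPhi hSSC Xa (phiX _ _ _ Xy) aE => ay.
      suff : set0 a by [].
      by rewrite -(hsep n).1; split=> //; rewrite ay; exists (w ord_max) => //;
        exists y.
    move=> S; rewrite (annular_components an') => -[->|->].
      by exists (projection X phi omega).
    have [i iO] := meet n Q Q h (or_intror erefl).
    (* A point of the limit set whose code agrees with [omega] except at level
       [j n], where its letter gives a piece outside [A n]. *)
    have [p Hp] := code_point hPhi (dfwith omega (j n) i).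
    exists p; split; first by apply: (cylinder_limit_set (omega :=
      dfwith omega (j n) i)) => k _; exact: Hp.
    have [x Xx <-] := Hp (j n).+1.
    move=> [a ABa aE].
    have Xa : X a by case: ABa => ?; [exact: (hAX n).1|exact: (hAX n).2].
    have wE : truncate (dfwith omega (j n) i) (j n) = truncate omega (j n).
      apply: functional_extensionality_dep => k; rewrite /truncate dfwithout //.
      by rewrite gtn_eqF.
    have aE' : word_map phi (truncate omega (j n)) a =
        word_map phi (truncate omega (j n)) (phi (j n) (dfwith omega (j n) i (j n)) x).
      by rewrite -[LHS]/(f n a) aE -wE.
    have ax : a = phi (j n) i x.
      rewrite -[ i ](dfwithin omega).
      exact: (word_map_cancel hPhi hSSC Xa (phiX _ _ _ Xx) aE').
    have : Q a by apply: iO; rewrite ax; exists x.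
    have : (A n `|` bounded_component (A n)) a by [].
    by rewrite (annular_fill h).
  by rewrite (annular_bounded_component an').
- have -> : (fun n => modulus (f n @` A n)) = (fun n => modulus (A n)).
    apply/funext => n; have [Q h] := an n.
    apply: (modulus_image (ann_open h));
      apply: conformal_sub (word_map_conformal hPhi _).
    exact: subset_trans (hAX n).1 XU.
  exact: hmod.
- apply: diameter_cvg0.
    by move=> n; have [Q h] := an n; have [x Ax] := ann_neq0 h; exists (f n x);
      exists x.
  move=> e e0; have [N HN] := word_map_small hPhi e0; exists N =>
    n Nn _ _ [x Ax <-] [y Ay <-].
  by apply: HN; [exact: leq_trans Nn (jn n)|exact: (hAX n).1|exact: (hAX n).1].
Qed.
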